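(* Let $\bar A=(A_0,A_1)$ be a compatible couple of (quasi-)Banach spaces with $A_0\cap A_1\neq\{0\}$. Let $0<\theta_0<\theta_1<1$, $0<\theta<1$, $0<r,r_0,r_1,q_0,q_1\le\infty$, $a,a_0,a_1,b_0,b_1\in SV$, $\left\|s^{-1/r_0}\frac{b_0(s)}{a_0(s)}\right\|_{r_0,(1,\infty)}<\infty$, and $\left\|s^{-1/r_1}\frac{b_1(s)}{a_1(s)}\right\|_{r_1,(0,1)}<\infty$. Put $c_0(t)=a_0(t)\left\|s^{-1/r_0}\frac{b_0(s)}{a_0(s)}\right\|_{r_0,(t,\infty)}$, $c_1(t)=a_1(t)\left\|s^{-1/r_1}\frac{b_1(s)}{a_1(s)}\right\|_{r_1,(0,t)}$, and $\rho(t)=t^{\theta_1-\theta_0}\frac{c_0(t)}{c_1(t)}$ for $t>0$. Then $$\left(\bar A^{\mathcal L}_{\theta_0,r_0,b_0,q_0,a_0},\bar A^{\mathcal R}_{\theta_1,r_1,b_1,q_1,a_1}\right)_{\theta,r,a}\cong\bar A_{\eta,r,a^{\#}},$$ where $\eta=(1-\theta)\theta_0+\theta\theta_1$ and $a^{\#}(t)=c_0(t)^{1-\theta}c_1(t)^{\theta}a(\rho(t))$.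
   Context: For a compatible couple $\bar X=(X_0,X_1)$ of (quasi-)Banach spaces, $f\in X_0+X_1$ and $t>0$, $K(t,f)=K(t,f;\bar X)=\inf\{\|f_0\|_{X_0}+t\|f_1\|_{X_1}: f=f_0+f_1,\ f_i\in X_i\}$. $\|\cdot\|_{q,(c,d)}$ ($0<q\le\infty$) is the usual (quasi-)norm of the Lebesgue space $L_q$ on the interval $(c,d)$ with Lebesgue measure (variable of integration: the displayed variable; $1/\infty=0$). $SV$ is the set of positive Lebesgue measurable functions $b$ on $(0,\infty)$ that are slowly varying: for each $\varepsilon>0$, $t^{\varepsilon}b(t)$ is equivalent to an increasing function and $t^{-\varepsilon}b(t)$ is equivalent to a decreasing function, where two positive functions are equivalent if each is bounded by a constant multiple of the other. For $0\le\theta\le1$, $0<q\le\infty$, $b\in SV$, $\bar X_{\theta,q,b}=(X_0,X_1)_{\theta,q,b}$ is the space of $f\in X_0+X_1$ with $\|f\|=\left\|u^{-\theta-1/q}b(u)K(u,f)\right\|_{q,(0,\infty)}<\infty$. For $0<\sigma<1$, $0<r,q\le\infty$, $a,b\in SV$, $\bar X^{\mathcal L}_{\sigma,r,b,q,a}$ is the space of $f\in X_0+X_1$ with $\|f\|=\left\|t^{-1/r}\frac{b(t)}{a(t)}\left\|u^{-\sigma-1/q}a(u)K(u,f)\right\|_{q,(0,t)}\right\|_{r,(0,\infty)}<\infty$, and $\bar X^{\mathcal R}_{\sigma,r,b,q,a}$ is the space of $f\in X_0+X_1$ with $\|f\|=\left\|t^{-1/r}\frac{b(t)}{a(t)}\left\|u^{-\sigma-1/q}a(u)K(u,f)\right\|_{q,(t,\infty)}\right\|_{r,(0,\infty)}<\infty$.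 $X\cong Y$ means that $X$ and $Y$ are continuously embedded in each other (same space, equivalent quasi-norms). *)

(* Defs.v *)
From HB Require Import structures.
From mathcomp Require Import all_boot all_order all_algebra.
From mathcomp Require Import all_classical all_reals all_analysis.

Set Implicit Arguments.
Unset Strict Implicit.
Unset Printing Implicit Defensive.

Import Order.TTheory GRing.Theory Num.Theory.
Import numFieldNormedType.Exports.

Local Open Scope classical_set_scope.
Local Open Scope ring_scope.

(* Scalars are real: a complex space is a real one
   by restriction of scalars, and the K-functional and the interpolation norms
   below use only addition and the norms. *)

(* A subspace of V together with a functional whose values matter only on the
   subspace. *)
Record qspace (R : realType) (V : lmodType R) := QSpace {
  carrier : set V;
  qnorm : V -> R }.

Section Spaces.
Context {R : realType} {V : lmodType R}.
Implicit Types X Y : qspace V.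

Definition is_subspace (S : set V) : Prop :=
  S 0 /\ forall (k : R) f g, S f -> S g -> S (k *: f + g).

Definition is_quasinorm X : Prop :=
  [/\ forall f, carrier X f -> 0 <= qnorm X f,
      forall f, carrier X f -> (qnorm X f = 0 <-> f = 0),
      forall (k : R) f, carrier X f -> qnorm X (k *: f) = `|k| * qnorm X f
    & exists C : R, forall f g, carrier X f -> carrier X g ->
        qnorm X (f + g) <= C * (qnorm X f + qnorm X g)].

Definition is_complete X : Prop :=
  forall u : nat -> V, (forall n, carrier X (u n)) ->
    (forall e : R, 0 < e -> \forall m & n \near \oo, qnorm X (u m - u n) < e) ->
    exists2 l, carrier X l & qnorm X (u n - l) @[n --> \oo] --> (0 : R).

Definition quasi_banach X : Prop :=
  [/\ is_subspace (carrier X), is_quasinorm X & is_complete X].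

Definition embedded X Y : Prop :=
  exists2 C : R, 0 < C & forall f, carrier X f ->
    carrier Y f /\ qnorm Y f <= C * qnorm X f.

Definition space_equiv X Y : Prop := embedded X Y /\ embedded Y X.

End Spaces.

(* E is not required to be locally convex. *)
Definition compatible_couple (R : realType) (E : topologicalLmodType R)
    (X0 X1 : qspace E) : Prop :=
  let continuously_included (X : qspace E) :=
    forall U : set E, nbhs (0 : E) U ->
      exists2 d : R, 0 < d & forall f, carrier X f -> qnorm X f < d -> U f in
  [/\ hausdorff_space E, quasi_banach X0, quasi_banach X1,
      continuously_included X0 & continuously_included X1].

Section Weights.
Context {R : realType}.

(* The (quasi-)norm of L_q on D, for Lebesgue measure (f \_ D extends f by 0).
   [lebesgue_measure] is
   defined on Borel sets, but library integrals of nonnegative functions are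
   suprema over simple functions and a.e. statements allow negligible sets, so
   for Lebesgue measurable f this is the usual value. *)
Definition Lq (q : \bar R) (D : set R) (f : R -> \bar R) : \bar R :=
  ('N[lebesgue_measure]_q [f \_ D])%E.

(* 1 / q, with 1 / +oo = 0 since fine +oo = 0 and 0^-1 = 0. *)
Definition einv (q : \bar R) : R := (fine q)^-1.

Definition lebesgue_measurable_fun (D : set R) (f : R -> R) : Prop :=
  forall Y : set R, measurable Y ->
    ((wlength idfun)^*)%mu.-cara.-measurable (D `&` f @^-1` Y).

Definition equivalent_fun (f g : R -> R) : Prop :=
  exists2 C : R, 0 < C &
    forall t, 0 < t -> f t <= C * g t /\ g t <= C * f t.

(* Monotonicity is non-strict; "equivalent to a strictly monotone function"
   would define the same class. *)
Definition SV (b : R -> R) : Prop :=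
  [/\ forall t, 0 < t -> 0 < b t,
      lebesgue_measurable_fun `]0, +oo[ b
    & forall e : R, 0 < e ->
        (exists2 g : R -> R, {in `]0, +oo[ &, {homo g : s t / s <= t}} &
           equivalent_fun (fun t => t `^ e * b t) g) /\
        (exists2 g : R -> R, {in `]0, +oo[ &, {homo g : s t /~ s <= t}} &
           equivalent_fun (fun t => t `^ (- e) * b t) g)].

End Weights.

Section Interpolation.
Context {R : realType} {V : lmodType R}.

Definition sum_space (X0 X1 : qspace V) : set V :=
  [set f0 + f1 | f0 in carrier X0 & f1 in carrier X1].

Definition Kfun (X0 X1 : qspace V) (t : R) (f : V) : \bar R :=
  ereal_inf [set (qnorm X0 g.1 + t * qnorm X1 g.2)%:E | g in
    [set g : V * V | [/\ carrier X0 g.1, carrier X1 g.2 & f = g.1 + g.2]]].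

Definition finite_part (X0 X1 : qspace V) (N : V -> \bar R) : qspace V :=
  {| carrier := [set f | sum_space X0 X1 f /\ (N f < +oo)%E];
     qnorm := fun f => fine (N f) |}.

(* ||u^(-s-1/q) b(u) K(u, f)||_{q, D} *)
Definition Knorm (X0 X1 : qspace V) (s : R) (q : \bar R) (b : R -> R)
    (D : set R) (f : V) : \bar R :=
  Lq q D (fun u => (u `^ (- s - einv q) * b u)%:E * Kfun X0 X1 u f)%E.

Definition interp (X0 X1 : qspace V) (theta : R) (q : \bar R) (b : R -> R) :
    qspace V :=
  finite_part X0 X1 (Knorm X0 X1 theta q b `]0, +oo[).

Definition interpL (X0 X1 : qspace V) (sigma : R) (r : \bar R) (b : R -> R)
    (q : \bar R) (a : R -> R) : qspace V :=
  finite_part X0 X1 (fun f => Lq r `]0, +oo[ (fun t =>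
    (t `^ (- einv r) * (b t / a t))%:E * Knorm X0 X1 sigma q a `]0%R, t[ f)%E).

Definition interpR (X0 X1 : qspace V) (sigma : R) (r : \bar R) (b : R -> R)
    (q : \bar R) (a : R -> R) : qspace V :=
  finite_part X0 X1 (fun f => Lq r `]0, +oo[ (fun t =>
    (t `^ (- einv r) * (b t / a t))%:E * Knorm X0 X1 sigma q a `]t, +oo[ f)%E).

End Interpolation.

(* ||s^(-1/r) b(s) / a(s)||_{r, D} *)
Definition ratio_norm (R : realType) (r : \bar R) (b a : R -> R) (D : set R) :
    \bar R :=
  Lq r D (fun s => (s `^ (- einv r) * (b s / a s))%:E).

(* Main.v *)
(* On the logarithmic scale slowly varying functions change by at most
   C exp(e |ln s - ln t|) for every e > 0, which makes t^(-s) b(t) K(t, f)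
   almost constant on the intervals [e^n, e^(n+1)).

   Write N_L, N_R for the two limiting norms, c0, c1 for their weights,
   w = rho^(- theta) a(rho), and K, K' for the K-functionals of the couples
   (A0, A1) and (L, R).  Restricting N_L to s > t and to u < t gives
   c0(t) t^(- theta0) K(t, f) <= C N_L(f), and similarly for N_R, so that
   c0(t) t^(- theta0) K(t, f) <= C K'(rho(t), f).  As
   t^(- eta) a#(t) = w(t) c0(t) t^(- theta0), this yields one embedding after
   the change of variables u = rho(t).

   For the other one, let x(s) = s^(- eta) a#(s) K(s, f) and let M bound
   x(s) min(s/t, t/s)^d for some small d.  In an almost optimal decomposition
   f = f0 + f1 for K(t, f), the functions u^(- theta0) K(u, f0) and
   u^(- theta1) K(u, f1) decay like a power of min(u/t, t/u), so the limiting
   norms of f0 and f1 are of the order of their weights at t, whence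
   w(t) K'(rho(t), f) <= C M; a Hardy-type inequality concludes. *)
Require Import Defs.
From HB Require Import structures.
From mathcomp Require Import all_boot all_order all_algebra.
From mathcomp Require Import all_classical all_reals all_analysis.
From mathcomp Require Import measurable_realfun ess_sup_inf zify ring lra.

Set Implicit Arguments.
Unset Strict Implicit.
Unset Printing Implicit Defensive.

Import Order.TTheory GRing.Theory Num.Theory.
Import numFieldNormedType.Exports.

Local Open Scope classical_set_scope.
Local Open Scope ring_scope.

(** * Regular variation *)

Section RegularVariation.
Context {R : realType}.
Implicit Types (f g : R -> R) (s t u al be : R).

(** The weights are only Lebesgue measurable, while integrals are taken for the Borel measure, as
    suprema over the simple functions below the integrand. Such an integral is monotone and
    homogeneous, but in general not additive in the integrand, so Minkowski, Fubini and substitution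
    cannot be applied to the functions at hand. Every norm estimate is therefore a pointwise
    comparison with an explicit exponential of the log distance [dl], a cut of the domain along an
    interval, or an exchange of a series and an integral in which the sampled values are constants.

    The function [rho] shares only the coarse features of a power: it need not be continuous,
    monotone or onto. The change of variables uses an inverse up to a bounded log distance, an error
    that almost constancy absorbs.

    The two families of limiting spaces differ only in the half-line that carries the inner norm, so
    one boolean treats both. *)

Definition dl s t : R := `|ln s - ln t|.

Lemma dl_ge0 s t : 0 <= dl s t. Proof. exact: normr_ge0. Qed.

Lemma dlC s t : dl s t = dl t s. Proof. exact: distrC. Qed.

Lemma dl_triangle t s u : dl s u <= dl s t + dl t u.
Proof. exact: ler_distD. Qed.

Lemma powR_exp t al : 0 < t -> t `^ al = expR (al * ln t).
Proof. by move=> t0; rewrite /powR gt_eqF. Qed.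

(* Regular variation of index [al], up to equivalence, expressed by Potter's
   bounds on the logarithmic scale. *)
Definition rv al f : Prop := (forall t, 0 < t -> 0 < f t) /\
  forall e, 0 < e -> exists2 C, 0 < C & forall s t, 0 < s -> 0 < t ->
    f s <= C * expR (al * (ln s - ln t) + e * dl s t) * f t.

Lemma rv_ext al be f g : al = be -> (forall t, 0 < t -> f t = g t) ->
  rv al f -> rv be g.
Proof.
move=> <- fg [f0 H]; split=> [t t0|e e0]; first by rewrite -fg// f0.
by have [C C0 h] := H e e0; exists C => // s t s0 t0; rewrite -!fg// h.
Qed.

Lemma rv_id : rv 1 (fun t => t).
Proof.
split=> // e e0; exists 1 => // s t s0 t0.
rewrite mul1r mul1r -[X in _ * X](@lnK _ t) ?posrE// -expRD.
rewrite -[X in X <= _](@lnK _ s) ?posrE// ler_expR.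
have := mulr_ge0 (ltW e0) (dl_ge0 s t); lra.
Qed.

Lemma rv_mul al be f g : rv al f -> rv be g -> rv (al + be) (fun t => f t * g t).
Proof.
move=> [f0 F] [g0 G]; split=> [t t0|e e0]; first by rewrite mulr_gt0 ?f0 ?g0.
have e20 : 0 < e / 2 by rewrite divr_gt0.
have [C C0 hF] := F _ e20; have [D D0 hG] := G _ e20.
exists (C * D) => [|s t s0 t0]; first exact: mulr_gt0.
have -> : (al + be) * (ln s - ln t) + e * dl s t =
  (al * (ln s - ln t) + e / 2 * dl s t) + (be * (ln s - ln t) + e / 2 * dl s t).
  by field.
rewrite expRD.
have fs := ltW (f0 s s0); have gs := ltW (g0 s s0).
by apply: le_trans (ler_pM fs gs (hF s t s0 t0) (hG s t s0 t0)) _; lra.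
Qed.

Lemma ln_le_exp (C x a b : R) : 0 < C -> 0 < a -> 0 < b ->
  a <= C * expR x * b -> ln a <= ln C + x + ln b.
Proof. by move=> C0 a0 b0 h; rewrite -ler_expR !expRD !lnK ?posrE. Qed.

(** For a negative exponent the upper bound needs a lower bound of [f s / f t], which is Potter's
    bound with [s] and [t] exchanged. The two together bound the absolute value of ln(f s / f t) -
    al ln(s / t), which is then multiplied by [p]. *)
Lemma rv_powR p al f : rv al f -> rv (al * p) (fun t => f t `^ p).
Proof.
move=> [f0 F]; split=> [t t0|e e0]; first by rewrite powR_gt0 ?f0.
have n0 : 0 < `|p| + 1 by rewrite ltr_wpDl.
(* The added 1 keeps the divisor nonzero when [p = 0]. *)
have [C C0 hF] := F (e / (`|p| + 1)) (divr_gt0 e0 n0).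
exists (expR (`|p| * `|ln C|)) => [|s t s0 t0]; first exact: expR_gt0.
have := hF s t s0 t0; have := hF t s t0 s0; rewrite (dlC t s).
set x := e / _ * _; move=> h1 h2.
have hx : `|p| * x <= e * dl s t.
  rewrite /x mulrA ler_wpM2r ?dl_ge0// mulrCA ger_pMr// ler_pdivrMr// mul1r.
  by rewrite lerDl.
have {h1}l1 := ln_le_exp C0 (f0 t t0) (f0 s s0) h1.
have {h2}l2 := ln_le_exp C0 (f0 s s0) (f0 t t0) h2.
rewrite !powR_exp ?f0// -!expRD ler_expR.
have l3 : `|(ln (f s) - ln (f t)) - al * (ln s - ln t)| <= `|ln C| + x.
  by rewrite ler_norml; have := ler_norm (ln C) => hC; apply/andP; split; lra.
have := ler_norm (p * ((ln (f s) - ln (f t)) - al * (ln s - ln t))).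
rewrite normrM => h3.
have h4 := ler_wpM2l (normr_ge0 p) l3.
rewrite [leRHS]mulrDr in h4; lra.
Qed.

Lemma rv_inv al f : rv al f -> rv (- al) (fun t => (f t)^-1).
Proof.
move=> h; apply: rv_ext (rv_powR (-1) h) => [|t t0]; first by rewrite mulrN1.
by rewrite powR_inv1 // ltW// h.1.
Qed.

Lemma rv_div al be f g : rv al f -> rv be g -> rv (al - be) (fun t => f t / g t).
Proof. by move=> hf /rv_inv; exact: rv_mul. Qed.

Lemma rv_pow al : rv al (fun t => t `^ al).
Proof. by rewrite -[al]mul1r; apply: rv_ext (rv_powR al rv_id); rewrite ?mul1r. Qed.

(** Potter's bound with e = 1, for the places where the size of the exponent is irrelevant. *)
Lemma rv_temperate al f : rv al f -> exists2 C, 0 < C & forall s t,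
  0 < s -> 0 < t -> f s <= C * expR ((`|al| + 1) * dl s t) * f t.
Proof.
move=> [f0 F]; have [C C0 h] := F 1 ltr01; exists C => // s t s0 t0.
apply: le_trans (h s t s0 t0) _; rewrite ler_wpM2r ?(ltW (f0 _ _))//.
rewrite ler_wpM2l ?(ltW C0)// ler_expR mulrDl lerD2r /dl -normrM.
exact: ler_norm.
Qed.

Lemma rv0_small f : rv 0 f -> forall e, 0 < e -> exists2 C, 0 < C & forall s t,
  0 < s -> 0 < t -> f s <= C * expR (e * dl s t) * f t.
Proof.
move=> [_ F] e e0; have [C C0 h] := F e e0; exists C => // s t s0 t0.
by have := h s t s0 t0; rewrite mul0r add0r.
Qed.

Lemma rv0_intro f : (forall t, 0 < t -> 0 < f t) ->
  (forall e, 0 < e -> exists2 C, 0 < C & forall s t,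
    0 < s -> 0 < t -> f s <= C * expR (e * dl s t) * f t) -> rv 0 f.
Proof.
move=> f0 F; split=> // e e0; have [C C0 h] := F e e0; exists C => // s t s0 t0.
by rewrite mul0r add0r h.
Qed.

(** Regularly varying functions are coarsely Lipschitz for the log distance; [rv_proper] below is
    the matching lower bound for positive index. *)
Lemma rv_dl al f : rv al f -> exists2 C, 0 < C & forall s t,
  0 < s -> 0 < t -> dl (f s) (f t) <= C + (`|al| + 1) * dl s t.
Proof.
move=> hf; have [f0 _] := hf; have [C C0 h] := rv_temperate hf.
have key s t : 0 < s -> 0 < t ->
    ln (f s) - ln (f t) <= `|ln C| + (`|al| + 1) * dl s t.
  move=> s0 t0; have := ln_le_exp C0 (f0 s s0) (f0 t t0) (h s t s0 t0).
  have := ler_norm (ln C); lra.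
exists (`|ln C| + 1) => [|s t s0 t0]; first by rewrite ltr_wpDl.
have := key s t s0 t0; have := key t s t0 s0; rewrite (dlC t s).
by rewrite {3}/dl ler_norml => h1 h2; apply/andP; split; lra.
Qed.

(** The inner function stretches log distances by a factor at most [|al| + 1], up to an additive
    constant. Dividing [e] by this factor compensates the stretching. *)
Lemma rv0_comp al f g : rv 0 f -> rv al g -> rv 0 (f \o g).
Proof.
move=> hf hg; have [g0 _] := hg; have [f0 _] := hf.
have [D D0 hD] := rv_dl hg.
apply: rv0_intro => [t t0|e e0]; first by rewrite /= f0 ?g0.
have n0 : 0 < `|al| + 1 by rewrite ltr_wpDl.
have [C C0 h] := rv0_small hf (divr_gt0 e0 n0).
exists (C * expR (e / (`|al| + 1) * D)) => [|s t s0 t0].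
  by rewrite mulr_gt0 ?expR_gt0.
apply: le_trans (h _ _ (g0 _ s0) (g0 _ t0)) _.
rewrite ler_wpM2r ?(ltW (f0 _ (g0 _ t0)))// -mulrA -expRD ler_wpM2l ?(ltW C0)//.
rewrite ler_expR; apply: le_trans (ler_wpM2l _ (hD s t s0 t0)) _.
  by rewrite divr_ge0 ?ltW.
by rewrite mulrDr lerD2l mulrA divfK ?gt_eqF.
Qed.

(* Half of the index absorbs the slowly varying factor. *)
Lemma rv_proper al f : 0 < al -> rv al f -> exists2 C, 0 < C & forall s t,
  0 < s -> 0 < t -> dl s t <= C + 2 / al * dl (f s) (f t).
Proof.
move=> al0 [f0 F].
have al20 : 0 < al / 2 by rewrite divr_gt0.
have [C C0 h] := F _ al20.
have key s t : 0 < s -> 0 < t -> ln t <= ln s ->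
    al / 2 * (ln s - ln t) <= `|ln C| + dl (f s) (f t).
  move=> s0 t0 ts; have := ln_le_exp C0 (f0 t t0) (f0 s s0) (h t s t0 s0).
  have -> : dl t s = ln s - ln t by rewrite /dl ler0_norm; lra.
  have := ler_norm (ln C); have := ler_norm (ln (f s) - ln (f t)).
  rewrite -/(dl _ _); lra.
exists (2 / al * `|ln C| + 1) => [|s t s0 t0].
  by rewrite ltr_wpDl// mulr_ge0// divr_ge0// ltW.
suff : dl s t <= 2 / al * (`|ln C| + dl (f s) (f t)) by rewrite mulrDr; lra.
rewrite -(@ler_pM2l _ (al / 2))// mulrA.
have -> : al / 2 * (2 / al) = 1 by field; rewrite gt_eqF.
rewrite mul1r; have [st|st] := lerP (ln t) (ln s).
  by rewrite {1}/dl ger0_norm ?subr_ge0//; exact: key.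
by rewrite {1}/dl ltr0_norm ?subr_lt0// opprB (dlC (f s)); exact/key/ltW.
Qed.

(** Without continuity the equation f(t) = u may have no solution. On the log scale, a point just
    below the supremum of {f <= u} and a point just above it are a bounded distance apart, so [f]
    jumps across [u] by a bounded factor. *)
Lemma rv_quasi_inverse al f : 0 < al -> rv al f ->
  exists2 C, 0 < C & forall u, 0 < u -> exists2 t, 0 < t & dl (f t) u <= C.
Proof.
move=> al0 hf; have [f0 F] := hf.
have al20 : 0 < al / 2 by rewrite divr_gt0.
have [C C0 h] := F _ al20.
have [D D0 hD] := rv_dl hf.
have hC s t : 0 < s -> 0 < t -> ln s <= ln t ->
    ln (f s) <= ln C + al / 2 * (ln s - ln t) + ln (f t).
  move=> s0 t0 st; have := ln_le_exp C0 (f0 s s0) (f0 t t0) (h s t s0 t0).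
  have -> : dl s t = ln t - ln s by rewrite /dl ler0_norm; lra.
  lra.
exists (D + (al + 1) * 4 + 1) => [|u u0].
  by rewrite ltr_wpDl// addr_ge0 ?mulr_ge0// ?addr_ge0 ?ltW.
pose S := [set x : R | ln (f (expR x)) <= ln u].
have eg (x : R) : 0 < expR x := expR_gt0 x.
have S0 : S !=set0.
  (* Half the index times this point outweighs all the constants, so [f] is already below [u] there;
     the opposite number bounds [S] from above for the same reason. *)
  exists (- (2 / al * (`|ln C| + `|ln (f 1)| + `|ln u|))); rewrite /S/=.
  set y := 2 / al * _.
  have y0 : 0 <= y by rewrite mulr_ge0 ?addr_ge0// divr_ge0// ltW.
  have := hC (expR (- y)) 1 (eg _) ltr01; rewrite expRK ln1 subr0 oppr_le0.
  move=> /(_ y0); have -> : al / 2 * - y = - (`|ln C| + `|ln (f 1)| + `|ln u|).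
    by rewrite /y; field; rewrite gt_eqF.
  have := ler_norm (ln C); have := ler_norm (ln (f 1)).
  have := ler_norm (- ln u); rewrite normrN; lra.
have Sb : ubound S (2 / al * (`|ln C| + `|ln (f 1)| + `|ln u|)).
  move=> x; rewrite /S/= => xS; set y := 2 / al * _.
  have y0 : 0 <= y by rewrite mulr_ge0 ?addr_ge0// divr_ge0// ltW.
  have [x0|x0] := lerP x 0; first exact: le_trans y0.
  have := hC 1 (expR x) ltr01 (eg _); rewrite expRK ln1 sub0r.
  move=> /(_ (ltW x0)) h1.
  have h2 : al / 2 * x <= `|ln C| + `|ln (f 1)| + `|ln u|.
    have := ler_norm (ln C); have := ler_norm (- ln (f 1)).
    have := ler_norm (ln u); rewrite normrN; lra.
  have -> : x = 2 / al * (al / 2 * x) by field; rewrite gt_eqF.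
  by rewrite ler_wpM2l// divr_ge0// ltW.
have hs : has_sup S by split=> //; eexists; exact: Sb.
(* The point [x] lies within 1 of the supremum, so [x + 2] is beyond it and outside [S]. *)
have [x xS xsup] := sup_adherent ltr01 hs.
exists (expR x) => //.
have hy : ln u < ln (f (expR (x + 2))).
  rewrite ltNge; apply/negP => /(ub_le_sup hs.2) /=; lra.
have := hD (expR (x + 2)) (expR x) (eg _) (eg _).
have -> : dl (expR (x + 2)) (expR x) = 2.
  by rewrite /dl !expRK addrAC subrr add0r ger0_norm.
rewrite (ger0_norm (ltW al0)).
move=> /(le_trans (ler_norm _)); rewrite /S/= in xS => h1.
rewrite {1}/dl ler0_norm; lra.
Qed.

(** For s <= t the increasing function equivalent to t^e b(t) gives the bound, for t < s the
    decreasing function equivalent to t^(-e) b(t). Each equivalence is used once at [s] and once at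
    [t], whence the squares. *)
Lemma SV_rv (b : R -> R) : SV b -> rv 0 b.
Proof.
move=> [b0 _ H]; apply: rv0_intro => // e e0.
have [[g gm [C C0 hC]] [k km [D D0 hD]]] := H e e0.
exists (C ^+ 2 + D ^+ 2) => [|s t s0 t0].
  by rewrite addr_gt0// exprn_gt0.
have sI x : 0 < x -> x \in `]0, +oo[ by rewrite in_itv/= andbT.
have eE p : expR (p * ln s) * expR (- (p * ln s)) = 1.
  by rewrite -expRD subrr expR0.
have [st|st] := lerP s t.
  have h : s `^ e * b s <= C ^+ 2 * (t `^ e * b t).
    apply: le_trans (hC s s0).1 _; rewrite expr2 -mulrA ler_wpM2l ?(ltW C0)//.
    apply: le_trans (hC t t0).2.
    by apply: gm; rewrite ?sI.
  have st' : ln s <= ln t by rewrite ler_ln ?posrE.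
  rewrite !powR_exp// in h.
  have -> : expR (e * dl s t) = expR (e * ln t) * expR (- (e * ln s)).
    by rewrite -expRD /dl ler0_norm ?subr_le0//; congr expR; ring.
  rewrite -(@ler_pM2l _ (expR (e * ln s))) ?expR_gt0//.
  apply: le_trans h _.
  rewrite [leRHS](_ : _ = (expR (e * ln s) * expR (- (e * ln s))) * ((C ^+ 2 + D ^+ 2) * (expR (e * ln t) * b t))); last by ring.
  rewrite eE mul1r ler_wpM2r ?lerDl ?sqr_ge0//.
  by rewrite mulr_ge0 ?expR_ge0// ltW// b0.
have h : s `^ (- e) * b s <= D ^+ 2 * (t `^ (- e) * b t).
  apply: le_trans (hD s s0).1 _; rewrite expr2 -mulrA ler_wpM2l ?(ltW D0)//.
  apply: le_trans (hD t t0).2.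
  by apply: km; rewrite ?sI// ltW.
have st' : ln t <= ln s by rewrite ler_ln ?posrE// ltW.
rewrite !powR_exp// in h.
have -> : expR (e * dl s t) = expR (- e * ln t) * expR (- (- e * ln s)).
  by rewrite -expRD /dl ger0_norm ?subr_ge0//; congr expR; ring.
rewrite -(@ler_pM2l _ (expR (- e * ln s))) ?expR_gt0//.
apply: le_trans h _.
rewrite [leRHS](_ : _ = (expR (- e * ln s) * expR (- (- e * ln s))) * ((C ^+ 2 + D ^+ 2) * (expR (- e * ln t) * b t))); last by ring.
rewrite eE mul1r ler_wpM2r ?lerDr ?sqr_ge0//.
by rewrite mulr_ge0 ?expR_ge0// ltW// b0.
Qed.

End RegularVariation.

(** * Norms for the measure du/u, without measurability *)

Section LowerIntegral.
Import HBNNSimple.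
Local Open Scope ereal_scope.
Context d (T : measurableType d) (R : realType).
Variable mu : {measure set T -> \bar R}.
Implicit Types (f g : T -> \bar R) (A D : set T).

(** The integral of a nonnegative function is a supremum over simple minorants, measurable or not;
    upper bounds can be tested on these, where the full theory of the integral applies. *)
Lemma integral_le_nnsfun f M : (forall x, 0 <= f x) ->
  (forall h : {nnsfun T >-> R}, (forall x, (h x)%:E <= f x) ->
     \int[mu]_x (h x)%:E <= M) ->
  \int[mu]_x f x <= M.
Proof.
move=> f0 H; rewrite ge0_integralTE//; apply/ge_ereal_sup => _ [h hf <-].
have := H h hf; rewrite integral_nnsfun//.
suff -> : (h \_ setT)%R = h :> (T -> R) by [].
by apply/funext => x; rewrite patchT// inE.
Qed.

Lemma nnsfun_le_integral f (h : {nnsfun T >-> R}) :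
  (forall x, (h x)%:E <= f x) -> \int[mu]_x (h x)%:E <= \int[mu]_x f x.
Proof.
move=> hf; have h0 x : 0 <= (h x)%:E by rewrite lee_fin; exact: fun_ge0.
rewrite [leRHS]ge0_integralTE//; last by move=> x; exact: le_trans (hf x).
apply: ereal_sup_ubound; exists h => //.
rewrite integral_nnsfun//; congr sintegral.
by apply/funext => x; rewrite patchT// inE.
Qed.

Lemma le_integral_nomeas f g : (forall x, 0 <= f x) ->
  (forall x, f x <= g x) -> \int[mu]_x f x <= \int[mu]_x g x.
Proof.
move=> f0 fg; apply: integral_le_nnsfun => // h hf.
by apply: nnsfun_le_integral => x; exact: le_trans (fg x).
Qed.

(** A simple minorant of [k f], divided by [k], is one of [f]. *)
Lemma integralZl_nomeas f (k : R) : (0 < k)%R -> (forall x, 0 <= f x) ->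
  \int[mu]_x (k%:E * f x) <= k%:E * \int[mu]_x f x.
Proof.
move=> k0 f0; apply: integral_le_nnsfun => [x|h hf].
  by rewrite mule_ge0// lee_fin ltW.
have ki0 : (0 <= k^-1)%R by rewrite invr_ge0 ltW.
rewrite -[leLHS]mul1e -[1%E](_ : (k * k^-1)%:E = _); last by rewrite divff ?gt_eqF.
rewrite EFinM -muleA lee_pmul2l ?lte_fin// -ge0_integralZl_EFin//; last 2 first.
- by move=> x _; rewrite lee_fin; exact: fun_ge0.
- exact/measurable_EFinP.
have : forall x, (scale_nnsfun h ki0 x)%:E <= f x.
  move=> x; rewrite -(@lee_pmul2l _ k%:E)// ?lte_fin//= -EFinM mulrA.
  by rewrite divff ?gt_eqF// mul1r.
by move/nnsfun_le_integral.
Qed.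

(* The lower integral of an arbitrary nonnegative function is additive along a
   measurable cut, although it is not additive in the integrand. *)
Lemma integral_cut_nomeas f A : measurable A -> (forall x, 0 <= f x) ->
  \int[mu]_x f x <= \int[mu]_x (f \_ A) x + \int[mu]_x (f \_ (~` A)) x.
Proof.
move=> mA f0; apply: integral_le_nnsfun => // h hf.
have h0 x : 0 <= (h x)%:E by rewrite lee_fin; exact: fun_ge0.
rewrite -[X in integral _ X _ <= _](setUv A) ge0_integral_setU//; last 3 first.
- exact: measurableC.
- by apply/measurable_EFinP; exact: measurable_funTS.
- by rewrite disj_set2E setICr.
apply: leeD; rewrite integral_mkcond; apply: le_integral_nomeas => x;
  by rewrite /patch; case: ifP => _ //; rewrite ?hf ?h0.
Qed.

End LowerIntegral.

(** * Monotonicity and homogeneity of L_q norms *)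

Section LqMonotone.
Local Open Scope ereal_scope.
Context {R : realType}.
Implicit Types (q : \bar R) (f g : R -> \bar R) (D : set R).

(** The norm at [q = +oo] is the essential supremum in the branch where the whole space has positive
    measure; this fact selects that branch. *)
Lemma lebesgue_setT_gt0 : 0 < (@lebesgue_measure R) [set: R].
Proof.
rewrite (_ : setT = [set` `]-oo, +oo[%R]); last by apply/seteqP; split.
by rewrite lebesgue_measure_itv /= addye// ltry.
Qed.

Lemma le_Lq q D D' f g : 0 < q -> D `<=` D' ->
  (forall x, D x -> 0 <= f x <= g x) -> (forall x, D' x -> 0 <= g x) ->
  Lq q D f <= Lq q D' g.
Proof.
move=> q0 DD fg g0.
have h x : `|(f \_ D) x| <= `|(g \_ D') x|.
  rewrite /patch; case: ifPn => [|_]; last by rewrite abse0 abse_ge0.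
  rewrite inE => Dx; have /andP[fx fgx] := fg x Dx.
  by rewrite mem_set; [rewrite !gee0_abs// g0//; exact: DD|exact: DD].
rewrite /Lq unlock; case: q q0 => [p|_|//].
- rewrite lte_fin => p0; apply: gt0_ler_poweR.
  + by rewrite invr_ge0 ltW.
  + by rewrite in_itv/= leey andbT integral_ge0// => x _; exact: poweR_ge0.
  + by rewrite in_itv/= leey andbT integral_ge0// => x _; exact: poweR_ge0.
  apply: le_integral_nomeas => x; first exact: poweR_ge0.
  by apply: gt0_ler_poweR; rewrite ?in_itv/= ?leey ?andbT ?abse_ge0 ?(ltW p0).
- by rewrite lebesgue_setT_gt0; apply: le_ess_sup; apply/nearW => x /=.
Qed.

Lemma Lq_scale q D f (k : R) : 0 < q -> (0 < k)%R ->
  (forall x, D x -> 0 <= f x) ->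
  Lq q D (fun x => k%:E * f x) <= k%:E * Lq q D f.
Proof.
move=> q0 k0 f0.
have E : abse \o ((fun x => k%:E * f x) \_ D) = fun x => k%:E * `|(f \_ D) x|.
  apply/funext => x /=; rewrite /patch; case: ifPn => _; last by rewrite abse0 mule0.
  by rewrite abseM gee0_abs// lee_fin ltW.
rewrite /Lq -[in leLHS]Lnorm_abse E unlock; case: q q0 => [p|_|//].
- rewrite lte_fin => p0.
  have -> : k%:E = (k%:E `^ p) `^ p^-1.
    by rewrite -poweRrM divff ?gt_eqF// poweRe1// lee_fin ltW.
  have i0 g : 0 <= \int[lebesgue_measure]_x (`|g x| `^ p).
    by apply: integral_ge0 => x _; exact: poweR_ge0.
  rewrite -poweRM ?poweR_ge0//.
  apply: gt0_ler_poweR; first by rewrite invr_ge0 ltW.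
  + by rewrite in_itv/= leey andbT integral_ge0// => x _; exact: poweR_ge0.
  + by rewrite in_itv/= leey andbT mule_ge0 ?poweR_ge0 ?i0// lee_fin powR_ge0.
  rewrite poweR_EFin; apply: le_trans (integralZl_nomeas _ _ _); last 2 first.
  + by rewrite powR_gt0.
  + by move=> x; exact: poweR_ge0.
  apply: le_integral_nomeas => x; first exact: poweR_ge0.
  rewrite -poweR_EFin -poweRrM divff ?gt_eqF// poweRe1 ?lee_fin ?(ltW k0)//.
  by rewrite abseM abse_id gee0_abs ?lee_fin ?(ltW k0)// poweRM// lee_fin ltW.
- rewrite lebesgue_setT_gt0 -ess_sup_pZl//; apply: le_ess_sup; apply/nearW => x /=.
  by rewrite abseM abse_id gee0_abs ?lee_fin ?(ltW k0).
Qed.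

End LqMonotone.

(** * Logarithmic cells and the measure du/u *)

Section Cells.
Context {R : realType}.
Implicit Types (s t u : R) (n : nat).

(** A bijection from the naturals to the integers, so that sums over all cells become series indexed
    by [nat]. Recall that [Negz m] is -(m + 1). *)
Definition zenum n : int := if odd n then Negz n./2 else Posz n./2.

Lemma zenum_surj (k : int) : exists n, zenum n = k.
Proof.
case: k => m; [exists m.*2|exists m.*2.+1]; rewrite /zenum /= odd_double /=.
  by rewrite doubleK.
by rewrite uphalf_double.
Qed.

Lemma zenum_inj : injective zenum.
Proof.
move=> m n; rewrite /zenum => mn.
rewrite -[m]odd_double_half -[n]odd_double_half; move: mn.
by case: (odd m); case: (odd n) => // -[->].
Qed.

(** Exponential decay in the integer index of a cell thus becomes geometric decay in [n]. *)
Lemma zenum_ge n : n%:R / 2 <= `|(zenum n)%:~R| :> R.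
Proof.
rewrite ler_pdivrMr// -[2]/(2%:R) /zenum.
have := odd_double_half n; case: (odd n) => /= nE.
  rewrite NegzE mulrNz normrN -pmulrn normr_nat -natrM ler_nat -{1}nE; lia.
by rewrite -pmulrn normr_nat -natrM ler_nat -{1}nE add0n muln2.
Qed.

Definition node t n : R := t * expR (zenum n)%:~R.

Definition cell t n : set R := `[node t n, node t n * expR 1[.

Lemma node_gt0 t n : 0 < t -> 0 < node t n.
Proof. by move=> t0; rewrite mulr_gt0 ?expR_gt0. Qed.

Lemma ln_node t n : 0 < t -> ln (node t n) = ln t + (zenum n)%:~R.
Proof. by move=> t0; rewrite lnM ?posrE ?expR_gt0// expRK. Qed.

Lemma cellE t n u : 0 < t -> cell t n u <-> 0 < u /\ Num.floor (ln u - ln t) = zenum n.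
Proof.
move=> t0; have n0 := node_gt0 n t0.
have E v : 0 < v -> (v \in `[node t n, node t n * expR 1[) =
    ((zenum n)%:~R <= ln v - ln t < (zenum n + 1)%:~R).
  move=> v0; rewrite in_itv/= -(@ler_ln _ (node t n)) ?posrE//.
  rewrite -(@ltr_ln _ v) ?posrE ?mulr_gt0 ?expR_gt0//.
  rewrite (@lnM _ (node t n)) ?posrE ?expR_gt0// expRK ln_node//.
  by rewrite lerBrDl ltrBlDl intrD addrA.
rewrite /cell /=; split=> [h|[u0 h]].
  have u0 : 0 < u by move: h; rewrite in_itv/= => /andP[/(lt_le_trans n0)].
  by split=> //; apply: floor_def; rewrite -E.
by rewrite E// -h floor_itv.
Qed.

Lemma cell_cover t u : 0 < t -> 0 < u -> exists n, cell t n u.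
Proof.
by move=> t0 u0; have [n nE] := zenum_surj (Num.floor (ln u - ln t)); exists n; apply/cellE.
Qed.

Lemma cell_disj t m n u : 0 < t -> cell t m u -> cell t n u -> m = n.
Proof. by move=> t0 /cellE-/(_ t0)[_ h] /cellE-/(_ t0)[_]; rewrite h => /zenum_inj. Qed.

Lemma cell_dl t n u : 0 < t -> cell t n u -> dl u (node t n) <= 1.
Proof.
move=> t0 /cellE-/(_ t0)[u0 h]; have := floor_itv (ln u - ln t).
rewrite h /dl ln_node// intrD => /andP[h1 h2].
by rewrite ger0_norm; lra.
Qed.

Lemma measurable_cell t n : measurable (cell t n).
Proof. exact: measurable_itv. Qed.

Lemma expR1_ge2 : 2 <= expR 1 :> R.
Proof. by have := @expR_ge1Dx R 1. Qed.

Lemma lebesgue_annulus (x : R) : 0 < x ->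
  lebesgue_measure (`[x, x * expR 1[%classic : set R) = (x * (expR 1 - 1))%:E.
Proof.
move=> x0; rewrite lebesgue_measure_itv/= lte_fin ltr_pMr//.
by rewrite expR_gt1 ltr01 EFinN -EFinB mulrBr mulr1.
Qed.

Local Open Scope ereal_scope.

Lemma term_le_nneseries (f : (\bar R)^nat) n : (forall i, 0 <= f i) ->
  f n <= \sum_(i <oo) f i.
Proof.
move=> f0; apply: le_trans (nneseries_lim_ge n.+1 _) => //.
by rewrite big_nat_recr//= leeDr// sume_ge0.
Qed.

Lemma nneseries_le (f : (\bar R)^nat) M : (forall i, 0 <= f i) ->
  (forall n, \sum_(0 <= i < n) f i <= M) -> \sum_(i <oo) f i <= M.
Proof.
move=> f0 H; apply: lime_le; first exact: is_cvg_nneseries.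
exact: nearW.
Qed.

(** The measure du/u is invariant under dilations, so the bound cannot depend on [t]. The integrand
    is dominated by a step function on the cells based at [t], with geometrically decreasing
    heights. *)
Lemma haar_exp (k : R) : (0 < k)%R -> exists2 C : R, (0 < C)%R & forall t, (0 < t)%R ->
  \int[lebesgue_measure]_x
     (((fun u => (u^-1 * expR (- k * dl u t))%:E) \_ `]0%R, +oo[) x) <= C%:E.
Proof.
(* A point of the cell [n] is at log distance at least n/2 - 1 from [t], so the kernel is at most
   e^k z^n there. *)
move=> k0; pose z : R := expR (- k / 2).
have z1 : (z < 1)%R by rewrite expR_lt1 mulNr oppr_lt0 divr_gt0.
have z0 : (0 < z)%R := expR_gt0 _.
have e1 : (0 < expR 1 - 1 :> R)%R by have := expR1_ge2; lra.
pose c n : R := (expR k * z ^+ n)%R.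
have c0 n : (0 < c n)%R by rewrite mulr_gt0 ?expR_gt0 ?exprn_gt0.
exists ((expR 1 - 1) * (expR k * (1 - z)^-1))%R => [|t t0].
  by rewrite !mulr_gt0 ?expR_gt0// invr_gt0 subr_gt0.
pose g n u := (c n / node t n)%:E * (\1_(cell t n) u)%:E.
have g0 n u : 0 <= g n u.
  by rewrite mule_ge0// lee_fin divr_ge0// ltW// ?c0// node_gt0.
apply: (@le_trans _ _ (\int[lebesgue_measure]_x (\sum_(n <oo) g n x))).
  apply: le_integral_nomeas => u.
    apply: erestrict_ge0 => v /=; rewrite in_itv/= andbT => v0.
    by rewrite lee_fin mulr_ge0 ?expR_ge0// invr_ge0 ltW.
  rewrite /patch; case: ifPn => [|_]; last exact: nneseries_ge0.
  rewrite inE/= in_itv/= andbT => u0.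
  have [n un] := cell_cover t0 u0.
  apply: le_trans (term_le_nneseries n _) => //.
  rewrite /g indicE mem_set// mule1 lee_fin mulrC.
  apply: ler_pM; rewrite ?expR_ge0 ?invr_ge0 ?(ltW u0)//.
    rewrite /c /z -expRM_natr -expRD ler_expR.
    have := cell_dl t0 un; have := zenum_ge n.
    rewrite /dl ln_node// => h1; rewrite ler_norml => /andP[h2 h3].
    have : (n%:R / 2 - 1 <= dl u t)%R.
      have := ler_norm (- (ln u - ln t))%R; rewrite normrN => h4.
      have := ler_norm (ln u - ln t)%R => h5; rewrite /dl.
      move: h1; case: (lerP 0 ((zenum n)%:~R : R)) => h6.
        by rewrite ger0_norm//; lra.
      by rewrite ltr0_norm//; lra.
    by move=> /(ler_wpM2l (ltW k0)); rewrite -/(dl _ _); lra.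
  rewrite lef_pV2 ?posrE ?node_gt0//.
  by move: un; rewrite /cell/= in_itv/= => /andP[].
rewrite integral_nneseries//; last first.
  move=> n; apply: measurable_funeM.
  by apply/measurable_EFinP; apply: measurable_indic; exact: measurable_cell.
apply: nneseries_le => [n|N].
  by apply: integral_ge0 => u _; exact: g0.
have -> : \sum_(0 <= i < N) \int[lebesgue_measure]_x g i x =
    \sum_(0 <= i < N) ((expR 1 - 1) * c i)%:E.
  apply: eq_bigr => i _; rewrite ge0_integralZl_EFin//; last 2 first.
  - by apply/measurable_EFinP; apply: measurable_indic; exact: measurable_cell.
  - by rewrite divr_ge0// ltW// ?c0// node_gt0.
  rewrite integral_indic//; last exact: measurable_cell.
  rewrite setIT [X in _ * X](_ : _ = (node t i * (expR 1 - 1))%:E);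
    last exact: lebesgue_annulus (node_gt0 i t0).
  rewrite -EFinM.
  congr EFin; field; by rewrite gt_eqF// node_gt0.
rewrite sumEFin lee_fin -mulr_sumr ler_wpM2l ?(ltW e1)//.
by apply: (geometric_le_lim N (expR_ge0 k) z0); rewrite gtr0_norm.
Qed.

(** Each cell has mass 1 for du/u. Replacing 1/u by its lower bound 1/(e [node t n]) makes the
    minorant a step function, hence measurable, and lowers the mass to (e - 1)/e; the factor 2e
    repairs this because 2(e - 1) >= 1. *)
Lemma haar_cell_sum (c : (\bar R)^nat) (H : R -> \bar R) t : (0 < t)%R ->
  (forall n, 0 <= c n) -> (forall u, 0 <= H u) ->
  (forall n u, cell t n u -> (u^-1)%:E * c n <= H u) ->
  \sum_(n <oo) c n <= (expR 1 * 2)%:E * \int[lebesgue_measure]_x H x.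
Proof.
move=> t0 c0 H0 cH; apply: nneseries_le => // N.
pose g n u := ((node t n * expR 1)^-1)%:E * c n * (\1_(cell t n) u)%:E.
have g0 n u : 0 <= g n u.
  by rewrite !mule_ge0// lee_fin invr_ge0 mulr_ge0 ?expR_ge0 ?ltW ?node_gt0.
have : \int[lebesgue_measure]_x (\sum_(0 <= n < N) g n x) <= \int[lebesgue_measure]_x H x.
  apply: le_integral_nomeas => u; first exact: sume_ge0.
  have [[n un]|nu] := pselect (exists n, cell t n u); last first.
    rewrite big1// => n _; rewrite /g indicE memNset ?mule0//.
    by move=> un; apply: nu; exists n.
  have gE m : m != n -> g m u = 0.
    move=> mn; rewrite /g indicE memNset ?mule0// => um.
    by move/eqP: mn; apply; exact: cell_disj um un.
  have gn : g n u <= H u.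
    apply: le_trans (cH n u un); rewrite /g indicE mem_set// mule1.
    rewrite lee_wpmul2r// lee_fin; move: un; rewrite /cell/= in_itv/= => /andP[h1 h2].
    rewrite lef_pV2 ?posrE ?mulr_gt0 ?expR_gt0 ?node_gt0//; first exact: ltW.
    by apply: lt_le_trans h1; exact: node_gt0.
  have [nN|nN] := ltnP n N.
    have -> : \sum_(0 <= m < N) g m u = g n u; last exact: gn.
    rewrite (bigD1_seq n) ?iota_uniq ?mem_index_iota//=.
    rewrite big1 => [|m mn]; first by rewrite adde0.
    exact: gE.
  have -> : \sum_(0 <= m < N) g m u = 0; last exact: H0.
  rewrite big_nat big1// => m /andP[_ mN]; apply: gE.
  by rewrite neq_ltn (leq_trans mN nN).
rewrite ge0_integral_sum//; last first.
  move=> n; apply: measurable_funeM.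
  by apply/measurable_EFinP; apply: measurable_indic; exact: measurable_cell.
have K0 : 0 <= (expR 1 * 2)%:E :> \bar R by rewrite lee_fin mulr_ge0// expR_ge0.
move=> /(lee_wpmul2l K0); apply: le_trans.
rewrite ge0_sume_distrr//; last first.
  by move=> n _; apply: integral_ge0 => u _; exact: g0.
apply: lee_sum => n _; have n0 := node_gt0 n t0.
rewrite /g ge0_integralZl//; last 2 first.
- by apply/measurable_EFinP; apply: measurable_indic; exact: measurable_cell.
- by rewrite mule_ge0// lee_fin invr_ge0 mulr_ge0 ?expR_ge0 ?ltW.
rewrite integral_indic//; last exact: measurable_cell.
rewrite setIT [X in _ * (_ * X)](_ : _ = (node t n * (expR 1 - 1))%:E);
  last exact: lebesgue_annulus.
rewrite muleAC -EFinM muleA -EFinM.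
rewrite -[leLHS]mul1e lee_wpmul2r// lee_fin.
have e2 := expR1_ge2; have e0 := expR_gt0 (1 : R).
rewrite [leRHS](_ : _ = 2 * (expR 1 - 1))%R; first by lra.
by field; rewrite !gt_eqF.
Qed.

End Cells.

(** * L_q norms for the measure du/u *)

Section HaarLq.
Context {R : realType}.
Implicit Types (q : \bar R) (f g : R -> \bar R) (D A : set R) (s t u : R).

Definition posR : set R := `]0, +oo[.

Lemma posRE u : posR u = (0 < u) :> Prop.
Proof. by rewrite /posR/= in_itv/= andbT. Qed.

(* The L_q norm on D for the measure du/u, also when q = +oo. *)
Definition haarLq q D f : \bar R :=
  Lq q D (fun u => (u `^ (- einv q))%:E * f u)%E.

Local Open Scope ereal_scope.

Lemma haarLq_ge0 q D f : 0 <= haarLq q D f.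
Proof. exact: Lnorm_ge0. Qed.

Lemma le_haarLq q D D' f g : 0 < q -> D `<=` D' ->
  (forall u, D u -> 0 <= f u <= g u) -> (forall u, D' u -> 0 <= g u) ->
  haarLq q D f <= haarLq q D' g.
Proof.
move=> q0 DD fg g0; apply: le_Lq => // u Du.
  have /andP[fu fgu] := fg u Du.
  by rewrite mule_ge0 ?lee_fin ?powR_ge0//= lee_wpmul2l// lee_fin powR_ge0.
by rewrite mule_ge0 ?lee_fin ?powR_ge0// g0.
Qed.

Lemma haarLq_scale q D f (k : R) : 0 < q -> (0 < k)%R ->
  (forall u, D u -> 0 <= f u) ->
  haarLq q D (fun u => k%:E * f u) <= k%:E * haarLq q D f.
Proof.
move=> q0 k0 f0; rewrite /haarLq.
under [X in Lq _ _ X <= _]eq_fun do rewrite muleCA.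
by apply: Lq_scale => // u Du; rewrite mule_ge0 ?f0// lee_fin powR_ge0.
Qed.

Lemma haarLq_le_scale q D D' f g (k : R) : 0 < q -> (0 < k)%R -> D `<=` D' ->
  (forall u, D u -> 0 <= f u <= k%:E * g u) -> (forall u, D' u -> 0 <= g u) ->
  haarLq q D f <= k%:E * haarLq q D' g.
Proof.
move=> q0 k0 DD fg g0; apply: le_trans (haarLq_scale _ _ _) => //.
by apply: le_haarLq => // u Du; rewrite mule_ge0 ?g0// lee_fin ltW.
Qed.

Lemma haarLq_fin (p : R) D f : (0 < p)%R -> D `<=` posR ->
  (forall u, D u -> 0 <= f u) ->
  haarLq p%:E D f =
  (\int[lebesgue_measure]_x (((fun u => (u^-1)%:E * f u `^ p) \_ D) x)) `^ p^-1.
Proof.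
move=> p0 Dp f0; rewrite /haarLq /Lq unlock; congr (_ `^ _).
apply: eq_integral => u _; rewrite /patch; case: ifPn => [|_]; last first.
  by rewrite abse0 poweR0r// gt_eqF.
rewrite inE => Du; have := Dp u Du; rewrite posRE => u0.
have h : 0 <= (u `^ (- einv p%:E))%:E :> \bar R by rewrite lee_fin powR_ge0.
rewrite gee0_abs ?mule_ge0 ?f0// poweRM ?f0// poweR_EFin -powRrM.
by rewrite /einv /= mulNr mulVf ?gt_eqF// powR_inv1// ltW.
Qed.

Lemma einv_pinfty : einv (+oo : \bar R) = 0%R.
Proof. by rewrite /einv /= invr0. Qed.

Lemma haarLq_infty_le D f M : 0 <= M ->
  (forall u, D u -> 0 <= f u <= M) -> haarLq +oo D f <= M.
Proof.
move=> M0 fM; rewrite /haarLq /Lq unlock lebesgue_setT_gt0.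
apply/ess_supP/nearW => u /=; rewrite /patch; case: ifPn => [|_]; last by rewrite abse0.
rewrite inE => /fM /andP[f0 fu].
by rewrite einv_pinfty oppr0 powRr0 mul1e gee0_abs.
Qed.

(** The annulus [x, e x) has mass 1 for du/u whatever [x] is, so the constant is uniform. For
    [q = +oo] it suffices that the annulus is not a null set. *)
Lemma haarLq_annulus q : 0 < q -> exists2 C : R, (0 < C)%R & forall x c D f,
  (0 < x)%R -> D `<=` posR -> 0 <= c -> (forall u, D u -> 0 <= f u) ->
  (forall u, (x <= u < x * expR 1)%R -> D u /\ c <= f u) ->
  c <= C%:E * haarLq q D f.
Proof.
case: q => [p||//]; last first.
  move=> _; exists 1%R => // x c D f x0 Dp c0 f0 H.
  rewrite mul1e /haarLq /Lq unlock lebesgue_setT_gt0.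
  set g := abse \o _.
  have [//|lt] := leP c (ess_sup lebesgue_measure g).
  have [N [mN N0 sN]] := ess_sup_ge lebesgue_measure g.
  have : lebesgue_measure ([set` `[x, x * expR 1[%R] : set R) <= lebesgue_measure N.
    apply: le_measure; rewrite ?inE//.
    move=> u; rewrite /= in_itv/= => xu; have [Du cu] := H u xu.
    apply: sN => /= gu; move: lt; rewrite ltNge => /negP; apply.
    apply: le_trans gu; rewrite /g/= /patch mem_set//.
    by rewrite einv_pinfty oppr0 powRr0 mul1e gee0_abs// f0.
  rewrite [leLHS](lebesgue_annulus x0) N0 lee_fin => h.
  have : (0 < x * (expR 1 - 1))%R by rewrite mulr_gt0//; have := @expR1_ge2 R; lra.
  by rewrite ltNge h.
rewrite lte_fin => p0.
exists ((expR 1 * 2) `^ p^-1)%R => [|x c D f x0 Dp c0 f0 H].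
  by rewrite powR_gt0// mulr_gt0 ?expR_gt0.
rewrite haarLq_fin// -poweR_EFin -poweRM//; last first.
  apply: integral_ge0 => u _; apply: erestrict_ge0 => v Dv.
  rewrite mule_ge0 ?poweR_ge0// lee_fin invr_ge0 ltW//.
  by have := Dp v Dv; rewrite posRE.
have -> : c = (c `^ p) `^ p^-1 by rewrite -poweRrM divff ?gt_eqF// poweRe1.
have H0 u : 0 <= ((fun u => (u^-1)%:E * f u `^ p) \_ D) u.
  apply: erestrict_ge0 => v Dv; rewrite mule_ge0 ?poweR_ge0// lee_fin invr_ge0 ltW//.
  by have := Dp v Dv; rewrite posRE.
apply: gt0_ler_poweR; rewrite ?invr_ge0 ?(ltW p0)//.
- by rewrite in_itv/= leey andbT poweR_ge0.
- by rewrite in_itv/= leey andbT; apply: mule_ge0 => //; exact: integral_ge0.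
(* Since [zenum 0 = 0], the cell of index 0 based at [x] is the annulus itself; all other terms
   vanish. *)
pose d n := if n == 0%N then c `^ p else 0.
have d0 n : 0 <= d n by rewrite /d; case: ifP => // _; exact: poweR_ge0.
apply: (@le_trans _ _ (\sum_(n <oo) d n)); first exact: (term_le_nneseries 0).
apply: (@haar_cell_sum _ _ _ x) => // n u; rewrite /d.
case: eqP => [->|_ _]; last by rewrite mule0.
rewrite /cell /node /zenum /= mulr0z expR0 mulr1 in_itv/= => xu.
have [Du cu] := H u xu; have := Dp u Du; rewrite posRE => u0.
rewrite /patch mem_set// lee_wpmul2l ?lee_fin ?invr_ge0 ?(ltW u0)//.
by apply: gt0_ler_poweR; rewrite ?in_itv/= ?leey ?andbT ?(ltW p0)// f0.
Qed.

Lemma haarLq_exp q (k : R) : 0 < q -> (0 < k)%R ->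
  exists2 C : R, (0 < C)%R & forall t, (0 < t)%R ->
    haarLq q posR (fun u => (expR (- k * dl u t))%:E) <= C%:E.
Proof.
case: q => [p||//]; last first.
  move=> _ k0; exists 1%R => // t t0; apply: haarLq_infty_le => // u u0.
  by rewrite !lee_fin expR_ge0/= expR_le1 mulNr oppr_le0 mulr_ge0 ?dl_ge0// ltW.
rewrite lte_fin => p0 k0; have [C C0 hC] := haar_exp (mulr_gt0 k0 p0).
exists (C `^ p^-1)%R => [|t t0]; first exact: powR_gt0.
rewrite haarLq_fin//.
rewrite -poweR_EFin; have := hC t t0.
set I1 := integral _ _ _; set I2 := integral _ _ _.
have -> : I1 = I2.
  apply: eq_integral => u _; rewrite /patch; case: ifPn => // _.
  by rewrite poweR_EFin -EFinM -expRM mulrAC !mulNr.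
move=> h; apply: gt0_ler_poweR; rewrite ?invr_ge0 ?(ltW p0)//.
- rewrite in_itv/= leey andbT; apply: integral_ge0 => u _; apply: erestrict_ge0 => v.
  by rewrite posRE => v0; rewrite mule_ge0 ?poweR_ge0// lee_fin invr_ge0 ltW.
- by rewrite in_itv/= leey andbT lee_fin ltW.
Qed.

(** This replaces the triangle inequality: the domain is cut instead of the integrand. *)
Lemma haarLq_cut q : 0 < q -> exists2 C : R, (0 < C)%R &
  forall A D f, measurable A -> D `<=` posR -> (forall u, D u -> 0 <= f u) ->
    haarLq q D f <= C%:E * (haarLq q (D `&` A) f + haarLq q (D `\` A) f).
Proof.
move=> q0; case: q q0 => [p||//]; last first.
  move=> _; exists 1%R => // A D f mA Dp f0; rewrite mul1e.
  rewrite /haarLq /Lq unlock lebesgue_setT_gt0; apply/ess_supP.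
  pose g u := (u `^ (- einv +oo))%:E * f u; rewrite -/g; set g1 := abse \o g \_ (D `&` A); set g2 := abse \o g \_ (D `\` A).
  apply: filterS2 (ess_sup_ge lebesgue_measure g1) (ess_sup_ge lebesgue_measure g2).
  move=> u h1 h2; have G1 : 0 <= g1 u by exact: abse_ge0.
  have G2 : 0 <= g2 u by exact: abse_ge0.
  apply: le_trans (leeD h1 h2); rewrite /= /g1 /g2 /patch /=.
  case: ifPn => [|_]; last by rewrite abse0 adde_ge0 ?abse_ge0.
  rewrite inE => Du; have [Au|Au] := pselect (A u).
    by rewrite (@mem_set _ (D `&` A))// leeDl.
  by rewrite (@mem_set _ (D `\` A))// leeDr.
rewrite lte_fin => p0; exists (2 `^ p^-1)%R => [|A D f mA Dp f0]; first exact: powR_gt0.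
have pi0 : (0 <= p^-1)%R by rewrite invr_ge0 ltW.
have DA : D `&` A `<=` D by move=> u [].
have DB : D `\` A `<=` D by move=> u [].
have fA u : (D `&` A) u -> 0 <= f u by move=> h; apply: f0; exact: DA.
have fB u : (D `\` A) u -> 0 <= f u by move=> h; apply: f0; exact: DB.
have pA : D `&` A `<=` posR by move=> u h; apply: Dp; exact: DA.
have pB : D `\` A `<=` posR by move=> u h; apply: Dp; exact: DB.
rewrite !haarLq_fin//.
pose g u := (u^-1)%:E * f u `^ p; rewrite -/g.
have g0 u : D u -> 0 <= g u.
  move=> Du; rewrite mule_ge0 ?poweR_ge0// lee_fin invr_ge0 ltW//.
  by have := Dp u Du; rewrite posRE.
have I0 B : B `<=` D -> 0 <= \int[lebesgue_measure]_x (g \_ B) x.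
  by move=> BD; apply: integral_ge0 => u _; apply: erestrict_ge0 => v h; apply: g0; exact: BD.
have : \int[lebesgue_measure]_x (g \_ D) x <=
    \int[lebesgue_measure]_x (g \_ (D `&` A)) x + \int[lebesgue_measure]_x (g \_ (D `\` A)) x.
  have := @integral_cut_nomeas _ _ _ lebesgue_measure (g \_ D) A mA.
  move=> /(_ (fun x => @erestrict_ge0 _ _ D g g0 x)).
  by rewrite -!patch_setI setIC (setIC (~` A)).
move: (I0 D (fun _ h => h)) (I0 _ DA) (I0 _ DB) => {I0}.
set I := integral _ _ _; set I1 := integral _ _ _; set I2 := integral _ _ _.
move=> I00 I10 I20 h; have i0 (x : \bar R) : 0 <= x -> x \in `[0, +oo].
  by move=> x0; rewrite in_itv/= leey andbT.
(* Bounding the sum by twice the larger integral gives the constant 2^(1/p) for every p, also below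
   1. *)
wlog h12 : I1 I2 I10 I20 h / I1 <= I2.
  move=> W; have /orP[h1|h1] := le_total I1 I2; first exact: W.
  by rewrite addeC; apply: W => //; rewrite addeC.
have h2 : I <= 2%:E * I2.
  by apply: le_trans h _; rewrite mule_natl mule2n leeD2r.
apply: (@le_trans _ _ ((2%:E * I2) `^ p^-1)).
  by apply: gt0_ler_poweR; rewrite ?i0// mule_ge0.
by rewrite poweRM// poweR_EFin lee_wpmul2l ?lee_fin ?powR_ge0// leeDr ?poweR_ge0.
Qed.

(** Almost constancy on intervals of log length 1 turns a norm into a pointwise bound: the value at
    [s] persists on the annulus [s, e s). *)
Lemma haarLq_sup q : 0 < q -> exists2 C : R, (0 < C)%R & forall (d : R) f,
  (0 < d)%R -> (forall u, (0 < u)%R -> 0 <= f u) ->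
  (forall s t, (0 < s)%R -> (0 < t)%R -> (dl s t <= 1)%R -> f s <= d%:E * f t) ->
  forall s, (0 < s)%R -> f s <= (C * d)%:E * haarLq q posR f.
Proof.
move=> q0; have [C C0 hC] := haarLq_annulus q0; exists C => // d f d0 f0 fD s s0.
have p0 u : posR u -> (0 < u)%R by rewrite posRE.
rewrite EFinM -muleA; apply: le_trans (lee_wpmul2l _ (haarLq_scale q0 d0 _)).
- apply: (hC s) => //; first exact: f0.
    by move=> u /p0 u0; rewrite mule_ge0 ?f0// lee_fin ltW.
  move=> u /andP[su us]; have u0 := lt_le_trans s0 su.
  split; first by rewrite posRE.
  apply: fD => //; rewrite /dl ler0_norm ?subr_le0 ?ler_ln ?posrE// opprB lerBlDl.
  by rewrite -[X in (_ + X)%R](@expRK R) -lnM ?posrE ?expR_gt0// ler_ln ?posrE ?mulr_gt0 ?expR_gt0// ltW.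
- by rewrite lee_fin ltW.
- by move=> u /p0/f0.
Qed.

(** In the transfer below, the kernel is the only factor that depends on the integration variable,
    so this is the measurability that the exchange of series and integral requires. *)
Lemma measurable_haar_exp (k t : R) : (0 < t)%R ->
  measurable_fun [set: R] ((fun u => (u^-1 * expR (- k * dl u t))%:E) \_ posR).
Proof.
move=> t0.
apply/(measurable_restrictT _ _).1; first exact: measurable_itv.
apply/measurable_EFinP.
apply: (eq_measurable_fun (fun u => expR (- ln u) * expR (- k * dl u t))%R).
  by move=> u; rewrite inE posRE => u0; rewrite expRN lnK// posrE.
apply: measurable_funTS; apply: measurable_funM.
  by apply: measurableT_comp => //; apply: measurableT_comp => //; exact: measurable_ln.
apply: measurableT_comp => //; apply: measurable_funM => //.
apply: measurableT_comp => //; apply: measurable_funB => //; exact: measurable_ln.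
Qed.

End HaarLq.

(** * A Hardy-type inequality by sampling *)

Section Transfer.
Context {R : realType}.
Local Open Scope ereal_scope.

(* A Hardy-type inequality that also changes variables by [tau].  Sampling [F]
   on the cells [e^n, e^(n+1)) turns it into the exchange of a sum and an
   integral, so that neither [F], [G] nor [tau] needs to be measurable. *)
Lemma haarLq_transfer (r : \bar R) (e D C : R) :
  0 < r -> (0 < e)%R -> (0 < D)%R -> (0 < C)%R ->
  exists2 C' : R, (0 < C')%R & forall (F G : R -> \bar R) (tau : R -> R),
  (forall s, (0 < s)%R -> (0 < tau s)%R) ->
  (forall s, (0 < s)%R -> 0 <= F s) -> (forall t, (0 < t)%R -> 0 <= G t) ->
  (forall s t, (0 < s)%R -> (0 < t)%R -> (dl s t <= 1)%R -> F s <= D%:E * F t) ->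
  (forall s t, (0 < s)%R -> (0 < t)%R -> (dl s t <= 1)%R ->
     (dl (tau s) (tau t) <= D)%R) ->
  (forall t M, (0 < t)%R -> (0 <= M)%R ->
     (forall s, (0 < s)%R -> (expR (- e * dl t (tau s)))%:E * F s <= M%:E) ->
     G t <= (C * M)%:E) ->
  haarLq r posR G <= C'%:E * haarLq r posR F.
Proof.
move=> r0 e0 D0 C0; have [C1 C10 hsup] := haarLq_sup r0.
case: r r0 hsup => [p||//]; last first.
  move=> r0 hsup; exists (C * (C1 * D))%R => [|F G tau t0 F0 G0 FD tD H].
    by rewrite !mulr_gt0.
  have L0 := haarLq_ge0 +oo posR F.
  have [Lfin|] := boolP (haarLq +oo posR F \is a fin_num); last first.
    rewrite ge0_fin_numE// -leNgt leye_eq => /eqP ->.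
    by rewrite gt0_muley ?leey// lte_fin !mulr_gt0.
  apply: haarLq_infty_le => [|u]; first by rewrite mule_ge0// lee_fin ltW// !mulr_gt0.
  rewrite posRE => u0; rewrite G0//= -(fineK Lfin) -EFinM -mulrA.
  apply: H => // [|s s0].
    by rewrite mulr_ge0 ?fine_ge0// ltW// mulr_gt0.
  rewrite EFinM fineK//; apply: le_trans (hsup _ _ D0 F0 FD s s0).
  rewrite -[leRHS]mul1e lee_wpmul2r ?F0// lee_fin expR_le1 mulNr oppr_le0.
  by rewrite mulr_ge0 ?dl_ge0// ltW.
rewrite lte_fin => p0 _.
have [C2 C20 hexp] := @haar_exp R (e * p) (mulr_gt0 e0 p0).
(* The cost of replacing [s] by the node of its cell: [D] for [F], and e^(e D) for the kernel, since
   [tau] moves by at most [D]. *)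
pose A := (D * expR (e * D))%R; have A0 : (0 < A)%R by rewrite mulr_gt0 ?expR_gt0.
have AE : A = (D * expR (e * D))%R by [].
clearbody A.
pose K := (((C * A) `^ p) * C2 * (expR 1 * 2) * D `^ p)%R.
have K0 : (0 < K)%R.
  have h : (0 < (C * A) `^ p)%R by apply: powR_gt0; exact: mulr_gt0.
  have h2 : (0 < D `^ p)%R by rewrite powR_gt0.
  by rewrite /K; do !apply: mulr_gt0 => //; exact: expR_gt0.
exists (K `^ p^-1)%R => [|F G tau t0 F0 G0 FD tD H]; first exact: powR_gt0.
have i0 (x : \bar R) : 0 <= x -> x \in `[0, +oo].
  by move=> x0; rewrite in_itv/= leey andbT.
have pp0 : (0 <= p)%R := ltW p0.
have pos (u : R) : posR u -> (0 < u)%R by rewrite posRE.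
have F0' u : posR u -> 0 <= F u by move/pos/F0.
have G0' u : posR u -> 0 <= G u by move/pos/G0.
rewrite !haarLq_fin//.
pose x n : R := node 1 n; have x0 n : (0 < x n)%R by exact: node_gt0.
pose IF := \int[lebesgue_measure]_x0 (((fun u => (u^-1)%:E * F u `^ p) \_ posR) x0).
have hF0 u : 0 <= ((fun u => (u^-1)%:E * F u `^ p) \_ posR) u.
  by apply: erestrict_ge0 => v /pos v0; rewrite mule_ge0 ?poweR_ge0// lee_fin invr_ge0 ltW.
have IF0 : 0 <= IF by apply: integral_ge0.
rewrite -/IF -poweR_EFin -poweRM// ?lee_fin ?(ltW K0)//.
apply: gt0_ler_poweR; rewrite ?invr_ge0//.
- apply: i0; apply: integral_ge0 => v _; apply: erestrict_ge0 => u /pos u0.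
  by rewrite mule_ge0 ?poweR_ge0// lee_fin invr_ge0 ltW.
- by apply: i0; rewrite mule_ge0// lee_fin ltW.
pose w n u := (expR (- (e * p) * dl u (tau (x n))))%:E : \bar R.
have w0 n u : 0 <= w n u by rewrite lee_fin expR_ge0.
(* A supremum over the nodes is at most the 1/p-th power of the sum of p-th powers, and a sum,
   unlike a supremum, can be integrated term by term. *)
pose S u := \sum_(n <oo) F (x n) `^ p * w n u.
have Sn0 n u : 0 <= F (x n) `^ p * w n u by rewrite mule_ge0 ?poweR_ge0.
have S0 u : 0 <= S u by exact: nneseries_ge0.
have GS u : (0 < u)%R -> G u `^ p <= ((C * A) `^ p)%:E * S u.
  move=> u0; have [Sfin|] := boolP (S u \is a fin_num); last first.
    rewrite ge0_fin_numE// -leNgt leye_eq => /eqP ->.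
    by rewrite gt0_muley ?leey// lte_fin; apply: powR_gt0; exact: mulr_gt0.
  have fS0 : (0 <= fine (S u))%R by exact: fine_ge0.
  have hG : G u <= (C * (A * fine (S u) `^ p^-1))%:E.
    apply: H => // [|s s0]; first by rewrite mulr_ge0 ?powR_ge0// ltW.
    have [n sn] := cell_cover ltr01 s0.
    have dn := cell_dl ltr01 sn; rewrite -/(x n) in dn.
    have Fs := FD s (x n) s0 (x0 n) dn.
    have h1 : (expR (- e * dl u (tau s)) <= expR (e * D) * expR (- e * dl u (tau (x n))))%R.
      rewrite -expRD ler_expR.
      have := dl_triangle (tau s) u (tau (x n)); have := tD s (x n) s0 (x0 n) dn.
      move=> h2 h3; have := ler_wpM2l (ltW e0) (le_trans h3 (lerD (lexx _) h2)).
      lra.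
    apply: (@le_trans _ _ (A%:E * (F (x n) `^ p * w n u) `^ p^-1)).
      rewrite poweRM ?poweR_ge0// -poweRrM divff ?gt_eqF// poweRe1 ?F0//.
      rewrite /w poweR_EFin -expRM.
      have -> : (- (e * p) * dl u (tau (x n)) * p^-1 = - e * dl u (tau (x n)))%R.
        by field; rewrite gt_eqF.
      apply: le_trans (lee_wpmul2l _ Fs) _; first by rewrite lee_fin expR_ge0.
      rewrite [leRHS](_ : _ = (expR (e * D) * expR (- e * dl u (tau (x n))))%:E * (D%:E * F (x n))).
        by rewrite lee_wpmul2r ?mule_ge0 ?F0// ?lee_fin// ltW.
      rewrite (muleC (F _)) !muleA -!EFinM; congr (_%:E * _).
      by rewrite AE; ring.
    rewrite [leRHS]EFinM lee_wpmul2l ?lee_fin ?(ltW A0)// -poweR_EFin fineK//.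
    apply: gt0_ler_poweR; rewrite ?invr_ge0 ?i0//.
    exact: (@term_le_nneseries _ (fun n => F (x n) `^ p * w n u) n).
  apply: (@le_trans _ _ ((C * (A * fine (S u) `^ p^-1))%:E `^ p)).
    by apply: gt0_ler_poweR; rewrite ?i0 ?G0// lee_fin !mulr_ge0 ?powR_ge0// ltW.
  rewrite poweR_EFin mulrA powRM ?powR_ge0 ?mulr_ge0 ?(ltW C0) ?(ltW A0)//.
  by rewrite -powRrM mulVf ?gt_eqF// powRr1// EFinM fineK.
pose h n (u : R) := ((fun v => (v^-1 * expR (- (e * p) * dl v (tau (x n))))%:E) \_ posR) u : \bar R.
have h0 : forall n u, 0 <= h n u.
  move=> n y; rewrite /h.
  by apply: erestrict_ge0 => v /pos v0; rewrite lee_fin mulr_ge0 ?expR_ge0// invr_ge0 ltW.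
have mh n : measurable_fun [set: R] (h n) by exact: (@measurable_haar_exp R (e * p) (tau (x n)) (t0 _ (x0 n))).
(* Each kernel has integral at most [C2], uniformly in the position [tau (x n)]; the remaining
   series of samples is a lower sum for the integral of F^p. *)
have Ih : \int[lebesgue_measure]_u (\sum_(n <oo) F (x n) `^ p * h n u) <=
    (C2 * (expR 1 * 2) * D `^ p)%:E * IF.
  rewrite integral_nneseries//; last 2 first.
  - by move=> n; apply: measurable_funeM; exact: mh.
  - by move=> n y _; rewrite mule_ge0 ?poweR_ge0.
  have -> : \sum_(n <oo) \int[lebesgue_measure]_u (F (x n) `^ p * h n u) =
      \sum_(n <oo) F (x n) `^ p * \int[lebesgue_measure]_u h n u.
    apply: eq_eseriesr => n _; apply: ge0_integralZl => //; first exact: mh.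
    exact: poweR_ge0.
  apply: (@le_trans _ _ (\sum_(n <oo) C2%:E * F (x n) `^ p)).
    apply: lee_nneseries => n _.
      by rewrite mule_ge0 ?poweR_ge0 ?integral_ge0.
    by rewrite muleC lee_wpmul2r ?poweR_ge0// hexp// t0.
  rewrite nneseriesZl; last by move=> n _; exact: poweR_ge0.
  rewrite -[(C2 * _ * _)%R]mulrA -mulrA EFinM -muleA lee_wpmul2l ?lee_fin ?(ltW C20)//.
  rewrite mulrA EFinM -muleA.
  apply: (@le_trans _ _ ((expR 1 * 2)%:E * \int[lebesgue_measure]_x0
      ((D `^ p)%:E * ((fun u => (u^-1)%:E * F u `^ p) \_ posR) x0))).
    apply: (@haar_cell_sum _ _ _ 1%R) => // [n|u|n u un].
    - exact: poweR_ge0.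
    - by rewrite mule_ge0// lee_fin powR_ge0.
    have u0 : (0 < u)%R by have /cellE-/(_ ltr01)[] := un.
    rewrite /patch mem_set ?posRE// muleCA lee_wpmul2l ?lee_fin ?invr_ge0 ?(ltW u0)//.
    rewrite -poweR_EFin -poweRM ?F0// ?lee_fin ?(ltW D0)//.
    apply: gt0_ler_poweR; rewrite ?i0 ?F0//.
      by rewrite mule_ge0 ?F0// lee_fin ltW.
    apply: FD => //; rewrite dlC; exact: cell_dl un.
  rewrite lee_wpmul2l ?lee_fin ?mulr_ge0 ?expR_ge0//.
  by apply: integralZl_nomeas => //; exact: powR_gt0.
apply: (@le_trans _ _ (\int[lebesgue_measure]_u
    (((C * A) `^ p)%:E * \sum_(n <oo) F (x n) `^ p * h n u))).
  apply: le_integral_nomeas => u.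
    by apply: erestrict_ge0 => v /pos v0; rewrite mule_ge0 ?poweR_ge0// lee_fin invr_ge0 ltW.
  rewrite {1}/patch; case: ifPn => [|_]; last first.
    rewrite mule_ge0 ?lee_fin ?powR_ge0// nneseries_ge0// => n _ _.
    by rewrite mule_ge0 ?poweR_ge0.
  rewrite inE => up; have u0 := pos u up.
  have -> : \sum_(n <oo) F (x n) `^ p * h n u = (u^-1)%:E * S u.
    rewrite -nneseriesZl//; apply: eq_eseriesr => n _.
    by rewrite /h /patch mem_set// EFinM muleCA.
  rewrite muleCA lee_wpmul2l ?GS// lee_fin invr_ge0 ltW//.
apply: le_trans (integralZl_nomeas _ _ _) _ => [|u|].
- by apply: powR_gt0; exact: mulr_gt0.
- by apply: nneseries_ge0 => n _ _; rewrite mule_ge0 ?poweR_ge0.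
have -> : K = ((C * A) `^ p * (C2 * (expR 1 * 2) * D `^ p))%R by rewrite /K; ring.
by rewrite EFinM -muleA lee_wpmul2l// lee_fin powR_ge0.
Qed.

End Transfer.

(** * One-sided norms of slowly varying functions *)

Section Sides.
Context {R : realType}.
Implicit Types (q r : \bar R) (sg : bool) (s t u : R) (a v k : R -> R).

(** In the limiting norms [side sg t] carries the inner norm, and [side (~~ sg) t] carries the ratio
    norm that defines the weight. *)
Definition side sg t : set R := if sg then `]0, t[%classic else `]t, +oo[%classic.

Lemma sideE sg t u : 0 < t ->
  side sg t u <-> 0 < u /\ (if sg then u < t else t < u).
Proof.
move=> t0; case: sg; rewrite /side/= in_itv/= ?andbT.
  by split=> [/andP[]|[-> ->]].
by split=> [tu|[]//]; split=> //; exact: lt_trans tu.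
Qed.

Lemma side_pos sg t : 0 < t -> side sg t `<=` posR.
Proof. by move=> t0 u /sideE-/(_ t0)[u0 _]; rewrite posRE. Qed.

Lemma measurable_side sg t : measurable (side sg t).
Proof. by case: sg; exact: measurable_itv. Qed.

Lemma side_sym sg s t : 0 < s -> 0 < t -> side sg s t -> side (~~ sg) t s.
Proof. by move=> s0 t0 /sideE-/(_ s0)[_ h]; apply/sideE => //; split=> //; case: sg h. Qed.

Lemma side_trans sg s t u : 0 < s -> 0 < t -> side sg s t -> side sg t u -> side sg s u.
Proof.
move=> s0 t0 /sideE-/(_ s0)[_ h] /sideE-/(_ t0)[u0 h']; apply/sideE => //; split=> //.
by case: sg h h' => h h'; [exact: lt_trans h|exact: lt_trans h'].
Qed.

Lemma sideN_sub sg s t : 0 < s -> 0 < t -> ~ side sg s t -> side sg s `<=` side sg t.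
Proof.
move=> s0 t0 h u /sideE-/(_ s0)[u0 h']; apply/sideE => //; split=> //.
case: sg h h' => h h'.
  by apply: lt_le_trans h' _; rewrite leNgt; apply/negP => ts; apply: h; apply/sideE.
by apply: le_lt_trans h'; rewrite leNgt; apply/negP => ts; apply: h; apply/sideE.
Qed.

(* Here [s] lies between [u] and [t]. *)
Lemma dl_side sg s t u : 0 < s -> 0 < t -> ~ side (~~ sg) t s -> side sg s u ->
  dl u t = dl u s + dl s t.
Proof.
move=> s0 t0 ts /sideE-/(_ s0)[u0 us].
have {}ts : if sg then ln s <= ln t else ln t <= ln s.
  by case: sg ts us => ts _; rewrite ler_ln ?posrE// leNgt; apply/negP => h; apply: ts;
    apply/sideE.
have {}us : if sg then ln u <= ln s else ln s <= ln u.
  by case: sg us {ts} => us; rewrite ler_ln ?posrE// ltW.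
rewrite /dl; case: sg ts us => ts us.
  by rewrite !ler0_norm; lra.
by rewrite !ger0_norm; lra.
Qed.

Lemma dl_side_diff sg s t u : 0 < s -> 0 < t -> (side sg s `\` side sg t) u ->
  dl u t <= dl s t.
Proof.
move=> s0 t0 [su tu]; have /sideE-/(_ s0)[u0 _] := su.
have /(dl_side u0 t0) : ~ side (~~ ~~ sg) t u by rewrite negbK.
by move=> /(_ _ (side_sym s0 u0 su)); move=> ->; rewrite lerDr dl_ge0.
Qed.

Local Open Scope ereal_scope.

Lemma haarLq_side q : 0 < q -> exists2 C : R, (0 < C)%R &
  forall sg t c (f : R -> \bar R), (0 < t)%R -> 0 <= c ->
  (forall u, side sg t u -> 0 <= f u) ->
  (forall u, (0 < u)%R -> side sg t u -> (dl u t <= 2)%R -> c <= f u) ->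
  c <= C%:E * haarLq q (side sg t) f.
Proof.
move=> q0; have [C C0 hC] := haarLq_annulus q0; exists C => // sg t c f t0 c0 f0 H.
have e1 : (1 < expR 1 :> R)%R by rewrite expR_gt1.
(* On the left the annulus [t/e, t) fits. On the right the side is open at [t], so the annulus [e t,
   e^2 t) is taken, which is why the log distance may reach 2. *)
have [x x0 hx] : exists2 x, (0 < x)%R & (ln x = if sg then ln t - 1 else ln t + 1)%R.
  by exists (expR (if sg then ln t - 1 else ln t + 1)%R); rewrite ?expR_gt0 ?expRK.
apply: (hC x) => //; first exact: side_pos.
move=> u /andP[xu ux]; have u0 := lt_le_trans x0 xu.
have h1 : (ln x <= ln u)%R by rewrite ler_ln ?posrE.
have h2 : (ln u < ln x + 1)%R.
  by rewrite -[X in (_ + X)%R](@expRK R) -lnM ?posrE ?expR_gt0// ltr_ln ?posrE ?mulr_gt0 ?expR_gt0.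
have su : side sg t u.
  apply/sideE => //; split=> //; move: h1 h2; rewrite hx; case: (sg) => h1 h2.
    by rewrite -ltr_ln ?posrE//; lra.
  by rewrite -ltr_ln ?posrE//; lra.
split=> //; apply: H => //; rewrite /dl ler_norml; move: h1 h2; rewrite hx.
by case: (sg) => h1 h2; apply/andP; split; lra.
Qed.

(** Within log distance 2 of [t], on either side, [v] is comparable with [v t]. This later absorbs
    isolated values of [v] into the weight. *)
Lemma haarLq_side_lower q v : 0 < q -> rv 0 v -> exists2 C : R, (0 < C)%R &
  forall sg t, (0 < t)%R -> (v t)%:E <= C%:E * haarLq q (side sg t) (EFin \o v).
Proof.
move=> q0 hv; have [v0 _] := hv; have [C C0 hC] := haarLq_side q0.
have [D D0 hD] := rv_temperate hv; rewrite normr0 add0r in hD.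
pose K := (D * expR 2)%R; have K0 : (0 < K)%R by rewrite mulr_gt0 ?expR_gt0.
exists (C * K)%R => [|sg t t0]; first exact: mulr_gt0.
have sp u : side sg t u -> (0 < u)%R by move=> /(side_pos t0); rewrite posRE.
rewrite EFinM -muleA; apply: le_trans (lee_wpmul2l _ (haarLq_scale q0 K0 _)).
- apply: hC => // [|u /sp u0|u u0 su ut] /=.
  + by rewrite lee_fin ltW ?v0.
  + by rewrite -EFinM lee_fin ltW// mulr_gt0// v0.
  + rewrite -EFinM lee_fin; apply: le_trans (hD t u t0 u0) _.
    rewrite ler_wpM2r ?(ltW (v0 _ u0))// ler_wpM2l ?(ltW D0)// ler_expR mul1r dlC.
    exact: ut.
- by rewrite lee_fin ltW.
- by move=> u /sp u0 /=; rewrite lee_fin ltW ?v0.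
Qed.

(** If the side of [s] is not inside that of [t], the excess lies between [s] and [t], where [v] is
    at most of order e^(e dl(s,t)) v(t), and v(t) is bounded by the one-sided norm at [t]. The
    estimate [key] holds for extended values, so finiteness at 1 spreads to every point. *)
Lemma haarLq_side_rv r sg v : 0 < r -> rv 0 v ->
  haarLq r (side sg 1%R) (EFin \o v) < +oo ->
  (forall t, (0 < t)%R -> haarLq r (side sg t) (EFin \o v) \is a fin_num) /\
  rv 0 (fun t => fine (haarLq r (side sg t) (EFin \o v))).
Proof.
move=> r0 hv; have [v0 _] := hv.
pose V t := haarLq r (side sg t) (EFin \o v); rewrite -/(V 1%R).
have V0 t : 0 <= V t by exact: haarLq_ge0.
have [K K0 hK] := haarLq_side_lower r0 hv.
have [Cc Cc0 hcut] := haarLq_cut r0.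
have key (e : R) : (0 < e)%R -> exists2 C : R, (0 < C)%R & forall s t,
    (0 < s)%R -> (0 < t)%R -> V s <= (C * expR (e * dl s t))%:E * V t.
  move=> e0; have e20 : (0 < e / 2)%R by rewrite divr_gt0.
  have [Cv Cv0 hCv] := rv0_small hv e20.
  have [Ce Ce0 hCe] := haarLq_exp r0 e20.
  exists (1 + Cc * (1 + Cv * Ce * K))%R => [|s t s0 t0].
    by rewrite addr_gt0 ?mulr_gt0 ?addr_gt0 ?mulr_gt0.
  have E1 : (1 <= expR (e * dl s t))%R.
    by rewrite -expR0 ler_expR mulr_ge0 ?dl_ge0// ltW.
  have sp u : side sg t u -> (0 < u)%R by move=> /(side_pos t0); rewrite posRE.
  have sp' u : side sg s u -> (0 < u)%R by move=> /(side_pos s0); rewrite posRE.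
  have [st|st] := pselect (side sg s t); last first.
    apply: (@le_trans _ _ (V t)).
      apply: le_haarLq => // [|u /sp' u0|u /sp u0].
      - exact: sideN_sub.
      - by rewrite /= lexx andbT lee_fin ltW ?v0.
      - by rewrite /= lee_fin ltW ?v0.
    rewrite -[leLHS]mul1e lee_wpmul2r// lee_fin -[leLHS]mulr1.
    apply: ler_pM => //; rewrite lerDl.
    by rewrite mulr_ge0 ?addr_ge0 ?mulr_ge0// ltW.
  apply: le_trans (hcut (side sg t) _ _ (measurable_side _ _) (side_pos s0) _) _.
    by move=> u /sp' u0 /=; rewrite lee_fin ltW ?v0.
  apply: (@le_trans _ _ (Cc%:E * (V t + (Cv * Ce * K * expR (e * dl s t))%:E * V t))).
    rewrite lee_wpmul2l ?lee_fin ?(ltW Cc0)//; apply: leeD.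
      apply: (le_haarLq r0).
      - exact: subIsetr.
      - by move=> u [/sp' u0 _] /=; rewrite lexx andbT lee_fin ltW ?v0.
      - by move=> u /sp u0; rewrite /= lee_fin ltW ?v0.
    (* On the excess dl(u,t) <= dl(s,t), so growth at rate e/2 in [u] may be traded for the full
       rate [e] at [s], leaving decay at rate e/2 in [u] for integrability. *)
    pose B := (Cv * expR (e * dl s t) * v t)%R.
    have B0 : (0 < B)%R by rewrite !mulr_gt0 ?expR_gt0 ?v0.
    have : haarLq r (side sg s `\` side sg t) (EFin \o v) <=
        B%:E * haarLq r posR (fun u => (expR (- (e / 2) * dl u t))%:E).
      apply: haarLq_le_scale => //.
        by move=> u [/(side_pos s0)].
      move=> u dut.
      have u0 : (0 < u)%R by case: dut => /sp'.
      rewrite /= lee_fin ltW ?v0//= -EFinM lee_fin.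
      apply: le_trans (hCv u t u0 t0) _.
      have -> : (B * expR (- (e / 2) * dl u t) =
          Cv * (expR (e * dl s t) * expR (- (e / 2) * dl u t)) * v t)%R.
        by rewrite /B; ring.
      rewrite ler_wpM2r ?(ltW (v0 _ t0))// ler_wpM2l ?(ltW Cv0)// -expRD ler_expR.
      have := ler_wpM2l (ltW e0) (dl_side_diff s0 t0 dut); lra.
    move/le_trans; apply.
    apply: (@le_trans _ _ (B%:E * Ce%:E)).
      by rewrite lee_wpmul2l ?hCe// lee_fin ltW.
    have -> : B%:E * Ce%:E = (Cv * Ce * expR (e * dl s t))%:E * (v t)%:E.
      by rewrite -!EFinM; congr EFin; rewrite /B; ring.
    have -> : (Cv * Ce * K * expR (e * dl s t) = Cv * Ce * expR (e * dl s t) * K)%R by ring.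
    rewrite [in leRHS]EFinM -muleA lee_wpmul2l ?hK// lee_fin.
    by rewrite !mulr_ge0 ?expR_ge0// ltW.
  rewrite -[X in X + _]mul1e -ge0_muleDl ?lee_fin ?mulr_ge0 ?expR_ge0 ?(ltW Cv0) ?(ltW Ce0) ?(ltW K0)//.
  rewrite muleA -EFinD -EFinM lee_wpmul2r// lee_fin.
  set E := expR _ in E1 *; have hp : (0 <= Cc * (E - 1))%R by rewrite mulr_ge0 ?subr_ge0// ltW.
  have : (0 <= E)%R by lra.
  lra.
move=> V1.
have Vfin t : (0 < t)%R -> V t \is a fin_num.
  move=> t0; rewrite ge0_fin_numE//; have [C C0 h] := key 1%R ltr01.
  apply: le_lt_trans (h t 1%R t0 ltr01) _.
  by rewrite -ge0_fin_numE ?mule_ge0 ?lee_fin ?mulr_ge0 ?expR_ge0 ?(ltW C0)// fin_numM// ge0_fin_numE.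
split=> //; apply: rv0_intro => [t t0|e e0].
  have := hK sg t t0; rewrite -/(V t) -(fineK (Vfin t t0)) -EFinM lee_fin => h.
  by have := lt_le_trans (v0 t t0) h; rewrite pmulr_rgt0.
have [C C0 h] := key e e0; exists C => // s t s0 t0.
by have := h s t s0 t0; rewrite -(fineK (Vfin s s0)) -(fineK (Vfin t t0)) -EFinM lee_fin.
Qed.

End Sides.

(** * Two-sided estimates of the limiting norms *)

Section LimitingNorm.
Context {R : realType}.
Implicit Types (q r : \bar R) (sg : bool) (s t u : R) (a v k : R -> R).
Local Open Scope ereal_scope.

(* The norm of the L-spaces ([sg = true]) and of the R-spaces ([sg = false])
   as a functional of [k u = u ^ (- sigma) K(u, f)], with [v = b / a]. *)
Definition limnorm sg r v q a k : \bar R :=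
  haarLq r posR (fun s => (v s)%:E *
    haarLq q (side sg s) (fun u => (a u * k u)%:E)).

Lemma limnorm_lower sg r q v a (P : R) : 0 < r -> 0 < q -> rv 0 v -> rv 0 a ->
  (0 <= P)%R ->
  exists2 C : R, (0 < C)%R & forall k t, (0 < t)%R ->
    (forall u, (0 < u)%R -> (0 <= k u)%R) ->
    (forall s u, (0 < s)%R -> (0 < u)%R -> (k s <= expR (P * dl s u) * k u)%R) ->
    (a t * k t)%:E * haarLq r (side (~~ sg) t) (EFin \o v) <=
      C%:E * limnorm sg r v q a k.
Proof.
move=> r0 q0 [v0 _] ha P0; have [a0 _] := ha.
have [C C0 hC] := haarLq_side q0.
have [D D0 hD] := rv_temperate ha; rewrite normr0 add0r in hD.
(* Both [a] and [k] are compared at log distance at most 2. *)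
have [K KE] : exists K, K = (D * expR (2 + 2 * P))%R by eexists.
have K0 : (0 < K)%R by rewrite KE mulr_gt0 ?expR_gt0.
exists (C * K)%R => [|k t t0 k0 kP]; first exact: mulr_gt0.
have sp sg' s u : (0 < s)%R -> side sg' s u -> (0 < u)%R.
  by move=> s0 /(side_pos s0); rewrite posRE.
have ak0 u : (0 < u)%R -> (0 <= a u * k u)%R.
  by move=> u0; rewrite mulr_ge0 ?k0// ltW ?a0.
have inner s : side (~~ sg) t s ->
    (a t * k t)%:E <= (C * K)%:E * haarLq q (side sg s) (fun u => (a u * k u)%:E).
  move=> ts; have s0 := sp _ _ _ t0 ts.
  have h1 : (a t * k t)%:E <= C%:E * (K%:E * haarLq q (side sg t) (fun u => (a u * k u)%:E)).
    apply: le_trans (lee_wpmul2l _ (haarLq_scale q0 K0 _)).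
    - apply: hC => // [|u /(sp _ _ _ t0) u0|u u0 su ut].
      + by rewrite lee_fin ak0.
      + by rewrite -EFinM lee_fin mulr_ge0 ?ak0// ltW.
      rewrite -EFinM lee_fin.
      have -> : (K * (a u * k u) = (D * expR 2 * a u) * (expR (2 * P) * k u))%R.
        by rewrite KE expRD; ring.
      apply: ler_pM; rewrite ?k0 ?(ltW (a0 _ t0))//.
        apply: le_trans (hD t u t0 u0) _.
        rewrite ler_wpM2r ?(ltW (a0 _ u0))// ler_wpM2l ?(ltW D0)// ler_expR mul1r dlC.
        exact: ut.
      apply: le_trans (kP t u t0 u0) _; rewrite ler_wpM2r ?k0// ler_expR dlC.
      by have := ler_wpM2l P0 ut; lra.
    - by rewrite lee_fin ltW.
    - by move=> u /(sp _ _ _ t0) u0; rewrite lee_fin ak0.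
  apply: le_trans h1 _; rewrite muleA -EFinM lee_wpmul2l//.
    by rewrite lee_fin mulr_ge0 ?(ltW K0)// ltW.
  apply: le_haarLq => // [u tu|u /(sp _ _ _ t0) u0|u /(sp _ _ _ s0) u0].
  - have := side_sym t0 s0 ts; rewrite negbK => st.
    exact: side_trans s0 t0 st tu.
  - by rewrite lexx andbT lee_fin ak0.
  - by rewrite lee_fin ak0.
have L0 : 0 <= limnorm sg r v q a k by exact: haarLq_ge0.
(* The value is moved out of the outer norm as a scalar, and scaling is available for positive
   scalars. *)
have [->|akn] := eqVneq (a t * k t)%R 0%R.
  by rewrite mul0e mule_ge0// lee_fin mulr_ge0 ?(ltW K0)// ltW.
have c0 : (0 < a t * k t)%R by rewrite lt0r akn ak0.
have ci0 : (0 < (a t * k t)^-1 * (C * K))%R.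
  by apply: mulr_gt0; [rewrite invr_gt0|exact: mulr_gt0].
have -> : (C * K = (a t * k t) * ((a t * k t)^-1 * (C * K)))%R.
  by rewrite mulrA divff// mul1r.
rewrite [X in _ <= X * _]EFinM -muleA lee_wpmul2l ?lee_fin ?(ltW c0)//.
apply: haarLq_le_scale => // [|s ts|s].
- exact: side_pos.
- have s0 := sp _ _ _ t0 ts; rewrite /= lee_fin (ltW (v0 _ s0))/=.
  rewrite muleCA -[leLHS]mule1 lee_wpmul2l ?lee_fin ?(ltW (v0 _ s0))//.
  rewrite EFinM -muleA -(@lee_pmul2l _ (a t * k t)%:E)// ?lte_fin//.
  by rewrite mule1 muleA -EFinM divff// mul1e inner.
- by rewrite posRE => s0; rewrite mule_ge0 ?haarLq_ge0// lee_fin ltW ?v0.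
Qed.

(** On the side that carries the weight the inner norm is of order B a(t). At the other [s], the
    inner domain lies beyond [s] as seen from [t], so the inner norm inherits the decay; the outer
    norm there is of order B a(t) v(t), and v(t) is bounded by the one-sided norm. *)
Lemma limnorm_upper sg r q v a (kap : R) : 0 < r -> 0 < q -> rv 0 v -> rv 0 a ->
  (0 < kap)%R ->
  exists2 C : R, (0 < C)%R & forall k t B, (0 < t)%R -> (0 < B)%R ->
    (forall u, (0 < u)%R -> (0 <= k u <= B * expR (- kap * dl u t))%R) ->
    limnorm sg r v q a k <=
      (C * (B * a t))%:E * haarLq r (side (~~ sg) t) (EFin \o v).
Proof.
move=> r0 q0 hv ha kap0; have [a0 _] := ha; have [v0 _] := hv.
(* Budget of the decay: inside, kap/2 pays for the variation of [a] and kap/2 for convergence;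
   outside, kap/4 pays for [a], kap/4 for [v], and kap/2 for convergence. *)
have k20 : (0 < kap / 2)%R by rewrite divr_gt0.
have k40 : (0 < kap / 4)%R by rewrite divr_gt0.
have [Ca Ca0 hCa] := rv0_small ha k20.
have [Ca' Ca0' hCa'] := rv0_small ha k40.
have [Cv Cv0 hCv] := rv0_small hv k40.
have [Eq Eq0 hEq] := haarLq_exp q0 k20.
have [Er Er0 hEr] := haarLq_exp r0 k20.
have [Kv Kv0 hKv] := haarLq_side_lower r0 hv.
have [Cc Cc0 hcut] := haarLq_cut r0.
have [M1 M1E] : exists M, M = (Ca * Eq)%R by eexists.
have M10 : (0 < M1)%R by rewrite M1E mulr_gt0.
have [M2 M2E] : exists M, M = (M1 * Ca' * Cv)%R by eexists.
have M20 : (0 < M2)%R by rewrite M2E !mulr_gt0.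
have MM0 : (0 < M1 + M2 * Er * Kv)%R by rewrite addr_gt0 ?mulr_gt0.
exists (Cc * (M1 + M2 * Er * Kv))%R => [|k t B t0 B0 hk]; first exact: mulr_gt0.
have sp sg' s u : (0 < s)%R -> side sg' s u -> (0 < u)%R.
  by move=> s0 /(side_pos s0); rewrite posRE.
have ak0 u : (0 < u)%R -> (0 <= a u * k u)%R.
  by move=> u0; have /andP[k0 _] := hk u u0; rewrite mulr_ge0// ltW ?a0.
pose I s := haarLq q (side sg s) (fun u => (a u * k u)%:E).
have I0 s : 0 <= I s by exact: haarLq_ge0.
have aB s : (0 < s)%R -> (0 < B * a s)%R by move=> s0; rewrite mulr_gt0 ?a0.
(* Here [a] is frozen at [y] and [x] is the decay gained: [y = t] with no gain in [innerA], [y = s]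
   with the full decay in [innerB]. *)
have inner0 s x y : (0 < s)%R -> (0 < x)%R -> (0 < y)%R ->
    (forall u, side sg s u -> (expR (kap / 2 * dl u y) * expR (- kap * dl u t) <=
       x * expR (- (kap / 2) * dl u y)))%R ->
    I s <= (M1 * (B * a y) * x)%:E.
  move=> s0 x0 y0 h.
  have z0 : (0 < Ca * (B * a y) * x)%R by rewrite !mulr_gt0 ?a0.
  have : I s <= (Ca * (B * a y) * x)%:E * haarLq q posR (fun u => (expR (- (kap / 2) * dl u y))%:E).
    apply: haarLq_le_scale => // [|u su]; first exact: side_pos.
    have u0 := sp _ _ _ s0 su; rewrite lee_fin ak0//= -EFinM lee_fin.
    have /andP[k0 ku] := hk u u0.
    apply: le_trans (ler_pM (ltW (a0 _ u0)) k0 (hCa u y u0 y0) ku) _.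
    have -> : (Ca * expR (kap / 2 * dl u y) * a y * (B * expR (- kap * dl u t)) =
      Ca * (B * a y) * (expR (kap / 2 * dl u y) * expR (- kap * dl u t)))%R by ring.
    rewrite -[leRHS]mulrA ler_wpM2l ?h// mulr_ge0 ?(ltW Ca0)//.
    by rewrite ltW ?aB.
  move/le_trans; apply.
  apply: (@le_trans _ _ ((Ca * (B * a y) * x)%:E * Eq%:E)).
    by rewrite lee_wpmul2l ?hEq// lee_fin ltW.
  by rewrite -EFinM lee_fin M1E le_eqVlt; apply/orP; left; apply/eqP; ring.
have innerA s : (0 < s)%R -> I s <= (M1 * (B * a t))%:E.
  move=> s0; rewrite -[(M1 * _)%R]mulr1; apply: inner0 => // u /(sp _ _ _ s0) u0.
  by rewrite mul1r -expRD ler_expR; lra.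
have innerB s : (0 < s)%R -> ~ side (~~ sg) t s ->
    I s <= (M1 * (B * a s) * expR (- kap * dl s t))%:E.
  move=> s0 ts; apply: inner0 => //; first exact: expR_gt0.
  move=> u su; rewrite -!expRD ler_expR (dl_side s0 t0 ts su).
  by have := dl_ge0 u s; lra.
rewrite /limnorm; set f := fun s => _ * _.
have f0 s : posR s -> 0 <= f s.
  by rewrite posRE => s0; rewrite mule_ge0 ?I0// lee_fin ltW ?v0.
apply: le_trans (hcut (side (~~ sg) t) _ _ (measurable_side _ _) (@subset_refl _ _) f0) _.
set V := haarLq r (side (~~ sg) t) (EFin \o v).
have V0 : 0 <= V by exact: haarLq_ge0.
have W0 : (0 < M1 * (B * a t))%R by rewrite mulr_gt0 ?aB.
have h1 : haarLq r (posR `&` side (~~ sg) t) f <= (M1 * (B * a t))%:E * V.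
  apply: (haarLq_le_scale r0 W0); first exact: subIsetr.
    move=> s [sP ts]; have s0 := sp _ _ _ t0 ts; rewrite f0//= /f muleC.
    by rewrite lee_wpmul2r ?innerA// lee_fin ltW ?v0.
  by move=> s /(sp _ _ _ t0) s0; rewrite /= lee_fin ltW ?v0.
have X0 : (0 < M2 * (B * a t) * v t)%R by rewrite !mulr_gt0 ?v0 ?a0.
have h2 : haarLq r (posR `\` side (~~ sg) t) f <= (M2 * (B * a t) * v t * Er)%:E.
  rewrite [leRHS]EFinM; apply: le_trans _ (lee_wpmul2l _ (hEr t t0)) => //; last by rewrite lee_fin ltW.
  apply: (haarLq_le_scale r0 X0); first exact: subDsetl; last by [].
  move=> s [sP ts]; rewrite f0//=; have s0 : (0 < s)%R by rewrite posRE in sP.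
  apply: le_trans (lee_wpmul2l _ (innerB s s0 ts)) _; first by rewrite lee_fin ltW ?v0.
  rewrite -!EFinM lee_fin.
  apply: le_trans (ler_wpM2r _ (hCv s t s0 t0)) _.
    by rewrite !mulr_ge0 ?expR_ge0 ?(ltW M10) ?(ltW B0) ?(ltW (a0 _ s0)).
  have -> : (M2 * (B * a t) * v t * expR (- (kap / 2) * dl s t) =
     Cv * expR (kap / 4 * dl s t) * v t * (M1 * (B *
       (Ca' * expR (kap / 4 * dl s t) * a t)) * expR (- kap * dl s t)))%R.
    have -> : (- (kap / 2) * dl s t = kap / 4 * dl s t + kap / 4 * dl s t + - kap * dl s t)%R.
      by field.
    by rewrite !expRD M2E; ring.
  rewrite ler_wpM2l ?mulr_ge0 ?expR_ge0 ?(ltW Cv0) ?(ltW (v0 _ t0))//.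
  rewrite ler_wpM2r ?expR_ge0// ler_wpM2l ?(ltW M10)// ler_wpM2l ?(ltW B0)//.
  exact: hCa'.
apply: le_trans (lee_wpmul2l _ (leeD h1 h2)) _; first by rewrite lee_fin ltW.
have h3 : (M2 * (B * a t) * v t * Er)%:E <= (M2 * Er * Kv * (B * a t))%:E * V.
  have -> : (M2 * (B * a t) * v t * Er = M2 * Er * (B * a t) * v t)%R by ring.
  have -> : (M2 * Er * Kv * (B * a t) = M2 * Er * (B * a t) * Kv)%R by ring.
  rewrite !(EFinM (M2 * Er * (B * a t))) -muleA lee_wpmul2l ?hKv// lee_fin.
  by rewrite !mulr_ge0 ?(ltW M20) ?(ltW Er0) ?(ltW B0) ?(ltW (a0 _ t0)).
apply: (@le_trans _ _ (Cc%:E * ((M1 * (B * a t))%:E * V + (M2 * Er * Kv * (B * a t))%:E * V))).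
  by rewrite lee_wpmul2l ?leeD2l// lee_fin ltW.
rewrite -ge0_muleDl ?lee_fin ?(ltW W0)//; last first.
  by rewrite !mulr_ge0 ?(ltW M20) ?(ltW Er0) ?(ltW Kv0) ?(ltW B0) ?(ltW (a0 _ t0)).
rewrite muleA -EFinD -EFinM lee_wpmul2r// lee_fin.
by rewrite le_eqVlt; apply/orP; left; apply/eqP; ring.
Qed.

End LimitingNorm.

(** * The K-functional and the limiting spaces *)

Section KFunctional.
Context {R : realType} {V : lmodType R}.
Implicit Types (X Y : qspace V) (f g : V) (s t u : R).

Definition nonneg_norm X := forall f, carrier X f -> 0 <= qnorm X f.

(** Outside the sum space the infimum is over the empty set, so [Kfun] is +oo and the real value
    defaults to 0. *)
Definition kfun X Y t f : R := fine (Kfun X Y t f).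

Section Nonneg.
Variables X Y : qspace V.
Hypotheses (X0 : nonneg_norm X) (Y0 : nonneg_norm Y).

Lemma Kfun_ge0 t f : 0 < t -> (0 <= Kfun X Y t f)%E.
Proof.
move=> t0; apply: le_ereal_inf_tmp => _ [[f0 f1] /= [h0 h1 _] <-].
by rewrite lee_fin addr_ge0 ?mulr_ge0 ?X0 ?Y0// ltW.
Qed.

Lemma Kfun_le t f0 f1 : carrier X f0 -> carrier Y f1 ->
  (Kfun X Y t (f0 + f1) <= (qnorm X f0 + t * qnorm Y f1)%:E)%E.
Proof. by move=> h0 h1; apply: ereal_inf_lbound; exists (f0, f1). Qed.

Lemma kfunE t f : 0 < t -> sum_space X Y f -> Kfun X Y t f = (kfun X Y t f)%:E.
Proof.
move=> t0 [f0 h0 [f1 h1 <-]]; rewrite /kfun fineK// ge0_fin_numE ?Kfun_ge0//.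
exact: le_lt_trans (Kfun_le t h0 h1) (ltry _).
Qed.

Lemma kfun_ge0 t f : 0 < t -> 0 <= kfun X Y t f.
Proof. by move=> t0; rewrite fine_ge0// Kfun_ge0. Qed.

Lemma kfun_le t f0 f1 : 0 < t -> carrier X f0 -> carrier Y f1 ->
  kfun X Y t (f0 + f1) <= qnorm X f0 + t * qnorm Y f1.
Proof.
move=> t0 h0 h1; rewrite -lee_fin -kfunE//; first exact: Kfun_le.
by exists f0 => //; exists f1.
Qed.

Lemma kfun_lt t f B : 0 < t -> sum_space X Y f -> kfun X Y t f < B ->
  exists f0 f1, [/\ carrier X f0, carrier Y f1, f = f0 + f1 &
    qnorm X f0 + t * qnorm Y f1 < B].
Proof.
move=> t0 hf; rewrite -lte_fin -kfunE// => /ereal_inf_lt[_ [[f0 f1] /= [h0 h1 h] <-]].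
by rewrite lte_fin => hB; exists f0, f1.
Qed.

(** The classical bound K(s) <= max(1, s/t) K(t), weakened to a symmetric one. *)
Lemma kfun_temperate s t f : 0 < s -> 0 < t -> sum_space X Y f ->
  kfun X Y s f <= expR (dl s t) * kfun X Y t f.
Proof.
move=> s0 t0 hf; rewrite leNgt mulrC -ltr_pdivlMr ?expR_gt0//.
apply/negP => /(kfun_lt t0 hf)[f0 [f1 [h0 h1 fE]]].
rewrite ltr_pdivlMr ?expR_gt0// => h.
have := kfun_le s0 h0 h1; rewrite -fE => /(lt_le_trans h); apply/negP; rewrite -leNgt.
rewrite mulrDl; apply: lerD.
  by rewrite ler_peMr ?X0// -expR0 ler_expR dl_ge0.
rewrite mulrAC ler_wpM2r ?Y0//.
rewrite -[X in X <= _](@lnK _ s) ?posrE// -[X in _ <= X * _](@lnK _ t) ?posrE//.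
by rewrite -expRD ler_expR; have := ler_norm (ln s - ln t); rewrite -/(dl _ _); lra.
Qed.

End Nonneg.

Lemma sum_space_add X Y f g : is_subspace (carrier X) -> is_subspace (carrier Y) ->
  sum_space X Y f -> sum_space X Y g -> sum_space X Y (f + g).
Proof.
move=> [_ sX] [_ sY] [f0 hf0 [f1 hf1 <-]] [g0 hg0 [g1 hg1 <-]].
exists (f0 + g0); first by have := sX 1 _ _ hf0 hg0; rewrite scale1r.
exists (f1 + g1); first by have := sY 1 _ _ hf1 hg1; rewrite scale1r.
by rewrite addrACA.
Qed.

Lemma quasi_norm_opp X f : is_subspace (carrier X) -> is_quasinorm X ->
  carrier X f -> carrier X (- f) /\ qnorm X (- f) = qnorm X f.
Proof.
move=> [h0 sX] [_ _ hZ _] hf; split.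
  by have := sX (-1) _ _ hf h0; rewrite scaleN1r addr0.
by rewrite -scaleN1r hZ// normrN1 mul1r.
Qed.

Lemma kfun_quasi_add X Y : is_subspace (carrier X) -> is_subspace (carrier Y) ->
  is_quasinorm X -> is_quasinorm Y ->
  exists2 C, 1 <= C & forall t f g, 0 < t -> sum_space X Y f -> sum_space X Y g ->
    kfun X Y t (f + g) <= C * (kfun X Y t f + kfun X Y t g).
Proof.
move=> sX sY [X0 _ _ [C0 hC0]] [Y0 _ _ [C1 hC1]].
(* The constants of the quasi-triangle inequalities carry no sign, hence the absolute values; the 1
   ensures [1 <= C]. *)
exists (`|C0| + `|C1| + 1) => [|t f g t0 hf hg]; first by rewrite lerDr addr_ge0.
set C := _ + 1; have C_gt0 : 0 < C by rewrite ltr_wpDl ?addr_ge0.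
rewrite leNgt -ltr_pdivlMl//; apply/negP => h.
(* Infima need not be attained: half of the strict gap is spent on each of the two
   decompositions. *)
pose d := (C^-1 * kfun X Y t (f + g) - (kfun X Y t f + kfun X Y t g)) / 2.
have d0 : 0 < d by rewrite divr_gt0// subr_gt0.
have [f0 [f1 [hf0 hf1 fE lf]]] := kfun_lt X0 Y0 t0 hf (ltr_pwDr d0 (lexx _)).
have [g0 [g1 [hg0 hg1 gE lg]]] := kfun_lt X0 Y0 t0 hg (ltr_pwDr d0 (lexx _)).
have hX : carrier X (f0 + g0) by have := sX.2 1 _ _ hf0 hg0; rewrite scale1r.
have hY : carrier Y (f1 + g1) by have := sY.2 1 _ _ hf1 hg1; rewrite scale1r.
have := kfun_le X0 Y0 t0 hX hY; rewrite addrACA -fE -gE; apply/negP; rewrite -ltNge.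
have nf0 := X0 _ hf0; have ng0 := X0 _ hg0.
have nf1 := Y0 _ hf1; have ng1 := Y0 _ hg1.
have b0 : qnorm X (f0 + g0) <= C * (qnorm X f0 + qnorm X g0).
  apply: le_trans (hC0 _ _ hf0 hg0) _; rewrite ler_wpM2r ?addr_ge0//.
  by have := ler_norm C0; have := normr_ge0 C1; rewrite /C; lra.
have b1 : qnorm Y (f1 + g1) <= C * (qnorm Y f1 + qnorm Y g1).
  apply: le_trans (hC1 _ _ hf1 hg1) _; rewrite ler_wpM2r ?addr_ge0//.
  by have := ler_norm C1; have := normr_ge0 C0; rewrite /C; lra.
apply: le_lt_trans (lerD b0 (ler_wpM2l (ltW t0) b1)) _.
rewrite (_ : _ + _ = C * ((qnorm X f0 + t * qnorm Y f1) + (qnorm X g0 + t * qnorm Y g1))); last by ring.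
rewrite -ltr_pdivlMl//; apply: lt_le_trans (ltrD lf lg) _.
by rewrite /d; lra.
Qed.

Lemma eq_Lq (q : \bar R) (D : set R) (f g : R -> \bar R) :
  (forall u, D u -> f u = g u) -> Lq q D f = Lq q D g.
Proof.
move=> fg; rewrite /Lq; congr Lnorm; apply/funext => u; rewrite /patch.
by case: ifPn => //; rewrite inE => /fg.
Qed.

Lemma Knorm_haarLq X Y (sigma : R) (q : \bar R) (b : R -> R) (D : set R) f :
  nonneg_norm X -> nonneg_norm Y -> D `<=` posR -> sum_space X Y f ->
  Knorm X Y sigma q b D f =
  haarLq q D (fun u => (b u * (u `^ (- sigma) * kfun X Y u f))%:E).
Proof.
move=> X0 Y0 Dp hf; apply: eq_Lq => u /Dp; rewrite posRE => u0.
rewrite kfunE// -!EFinM; congr EFin.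
by rewrite powRD; [ring|rewrite (gt_eqF u0) implybT].
Qed.

Lemma limnormE sg X Y (sigma : R) (r q : \bar R) (b a : R -> R) f :
  nonneg_norm X -> nonneg_norm Y -> sum_space X Y f ->
  Lq r `]0, +oo[ (fun t => (t `^ (- einv r) * (b t / a t))%:E *
     Knorm X Y sigma q a (side sg t) f)%E =
  limnorm sg r (fun t => b t / a t) q a (fun u => u `^ (- sigma) * kfun X Y u f).
Proof.
move=> X0 Y0 hf; apply: eq_Lq => t tp.
have t0 : 0 < t by rewrite -posRE.
by rewrite EFinM -muleA Knorm_haarLq//; exact: side_pos.
Qed.

Lemma ratio_normE (r : \bar R) (b a : R -> R) (D : set R) :
  ratio_norm r b a D = haarLq r D (EFin \o (fun s => b s / a s)).
Proof. by apply: eq_Lq => u _ /=; rewrite EFinM. Qed.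

Lemma finite_part_nonneg X Y N : (forall f, 0 <= N f)%E ->
  nonneg_norm (finite_part X Y N).
Proof. by move=> N0 f _; rewrite /= fine_ge0. Qed.

End KFunctional.

(** * Limiting spaces and their weights *)

Section LimitingSpaces.
Context {R : realType} {V : lmodType R}.
Variables A0 A1 : qspace V.
Hypotheses (A0_ge0 : nonneg_norm A0) (A1_ge0 : nonneg_norm A1).

Lemma weighted_kfun_temperate (b : R -> R) (sigma : R) : rv 0 b ->
  exists D P, [/\ 0 < D, 0 <= P & forall X Y : qspace V,
    nonneg_norm X -> nonneg_norm Y -> forall f s t, sum_space X Y f -> 0 < s -> 0 < t ->
    b s * (s `^ (- sigma) * kfun X Y s f) <=
      D * expR (P * dl s t) * (b t * (t `^ (- sigma) * kfun X Y t f))].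
Proof.
move=> hb; have hg := rv_mul hb (rv_pow (- sigma)).
have [D D0 hD] := rv_temperate hg; have [g0 _] := hg.
exists D, (`|0 - sigma| + 1 + 1); split; [by []|by rewrite !addr_ge0|move=> X Y X0 Y0 f s t hf s0 t0].
rewrite !mulrA.
have -> : D * expR ((`|0 - sigma| + 1 + 1) * dl s t) * b t * t `^ (- sigma) * kfun X Y t f =
  (D * expR ((`|0 - sigma| + 1) * dl s t) * (b t * t `^ (- sigma))) *
    (expR (dl s t) * kfun X Y t f).
  by rewrite mulrDl mul1r expRD; ring.
apply: ler_pM; [exact/ltW/g0|exact: kfun_ge0|exact: hD|exact: kfun_temperate].
Qed.

(* [sg = true] gives the L-spaces and [sg = false] the R-spaces. *)
Definition limspace sg (sigma : R) (r : \bar R) (b : R -> R) (q : \bar R) (a : R -> R) :=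
  finite_part A0 A1 (fun f => Lq r `]0, +oo[ (fun t =>
    (t `^ (- einv r) * (b t / a t))%:E * Knorm A0 A1 sigma q a (side sg t) f)%E).

Variables (sg : bool) (sigma : R) (r q : \bar R) (b a : R -> R).
Hypotheses (r_gt0 : (0 < r)%E) (q_gt0 : (0 < q)%E) (hb : rv 0 b) (ha : rv 0 a).
Hypothesis hfin : (ratio_norm r b a (side (~~ sg) 1) < +oo)%E.

Let v s := b s / a s.
Let rv_v : rv 0 v. Proof. by have := rv_div hb ha; rewrite subr0. Qed.
Let X := limspace sg sigma r b q a.
Let c t := a t * fine (ratio_norm r b a (side (~~ sg) t)).

Lemma limspace_nonneg : nonneg_norm X.
Proof. by apply: finite_part_nonneg => f; exact: Lnorm_ge0. Qed.

Lemma limspace_tail :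
  (forall t, 0 < t -> ratio_norm r b a (side (~~ sg) t) \is a fin_num) /\
  rv 0 (fun t => fine (ratio_norm r b a (side (~~ sg) t))).
Proof.
have := hfin; rewrite ratio_normE => /(haarLq_side_rv r_gt0 rv_v)[h1 h2].
split=> [t t0|]; first by rewrite ratio_normE h1.
by apply: rv_ext h2 => // t t0; rewrite ratio_normE.
Qed.

Lemma limspace_weight_rv : rv 0 c.
Proof. by have := rv_mul ha limspace_tail.2; rewrite addr0. Qed.

Lemma limspace_lower : exists2 C, 0 < C & forall f t, 0 < t -> carrier X f ->
  c t * (t `^ (- sigma) * kfun A0 A1 t f) <= C * qnorm X f.
Proof.
(* The power contributes the rate [|sigma|] and the K-functional the rate 1. *)
have P0 : 0 <= `|sigma| + 1 by rewrite addr_ge0.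
have [C C0 hC] := limnorm_lower sg r_gt0 q_gt0 rv_v ha P0.
exists C => // f t t0 [hf Nf].
have NE := limnormE sg sigma r q b a A0_ge0 A1_ge0 hf.
rewrite -lee_fin [in leRHS]EFinM /= fineK; last by rewrite ge0_fin_numE// Lnorm_ge0.
rewrite NE; pose k u := u `^ (- sigma) * kfun A0 A1 u f; rewrite -/k -/(k t).
have -> : (c t * k t = (a t * k t) * fine (ratio_norm r b a (side (~~ sg) t)))%R.
  by rewrite /c; ring.
rewrite [X in (X <= _)%E]EFinM fineK ?limspace_tail.1// ratio_normE; apply: hC => //.
  by move=> u u0; rewrite /k mulr_ge0 ?powR_ge0// kfun_ge0.
move=> s u s0 u0; rewrite /k mulrDl mul1r expRD mulrACA.
apply: ler_pM; rewrite ?powR_ge0 ?kfun_ge0// ?kfun_temperate//.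
rewrite !powR_exp// -expRD ler_expR.
have := ler_norm (- sigma * (ln s - ln u)); rewrite normrM normrN -/(dl _ _); lra.
Qed.

Lemma limspace_upper kap : 0 < kap -> exists2 C, 0 < C & forall f t B,
  0 < t -> 0 < B -> sum_space A0 A1 f ->
  (forall u, 0 < u -> u `^ (- sigma) * kfun A0 A1 u f <= B * expR (- kap * dl u t)) ->
  carrier X f /\ qnorm X f <= C * (B * c t).
Proof.
move=> kap0; have [C C0 hC] := limnorm_upper sg r_gt0 q_gt0 rv_v ha kap0.
exists C => // f t B t0 B0 hf hk.
have NE := limnormE sg sigma r q b a A0_ge0 A1_ge0 hf.
have h : (limnorm sg r v q a (fun u => u `^ (- sigma) * kfun A0 A1 u f)%R <= (C * (B * c t))%:E)%E.
  have -> : C * (B * c t) = C * (B * a t) * fine (ratio_norm r b a (side (~~ sg) t)).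
    by rewrite /c; ring.
  rewrite EFinM fineK ?limspace_tail.1// ratio_normE; apply: hC => // u u0.
  by rewrite hk// mulr_ge0 ?powR_ge0// kfun_ge0.
rewrite /X /=; split; first by split=> //; rewrite NE (le_lt_trans h)// ltry.
rewrite NE -lee_fin fineK//.
by rewrite ge0_fin_numE ?haarLq_ge0// (le_lt_trans h)// ltry.
Qed.

End LimitingSpaces.

(** * Reiteration *)

Section Reiteration.
Context {R : realType} {V : lmodType R}.
Variables (A0 A1 : qspace V).
Hypotheses (sA0 : is_subspace (carrier A0)) (sA1 : is_subspace (carrier A1)).
Hypotheses (qA0 : is_quasinorm A0) (qA1 : is_quasinorm A1).
Variables (theta0 theta1 theta : R) (r r0 r1 q0 q1 : \bar R).
Variables (a a0 a1 b0 b1 : R -> R).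
Hypotheses (htheta0 : 0 < theta0) (htheta01 : theta0 < theta1) (htheta1 : theta1 < 1).
Hypotheses (htheta : 0 < theta) (htheta' : theta < 1).
Hypotheses (hr : (0 < r)%E) (hr0 : (0 < r0)%E) (hr1 : (0 < r1)%E)
  (hq0 : (0 < q0)%E) (hq1 : (0 < q1)%E).
Hypotheses (ha : rv 0 a) (ha0 : rv 0 a0) (ha1 : rv 0 a1) (hb0 : rv 0 b0) (hb1 : rv 0 b1).
Hypotheses (hfin0 : (ratio_norm r0 b0 a0 `]1%R, +oo[ < +oo)%E)
  (hfin1 : (ratio_norm r1 b1 a1 `]0%R, 1%R[ < +oo)%E).

Let c0 t := a0 t * fine (ratio_norm r0 b0 a0 `]t, +oo[).
Let c1 t := a1 t * fine (ratio_norm r1 b1 a1 `]0, t[).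
Let rho t := t `^ (theta1 - theta0) * (c0 t / c1 t).
Let eta := (1 - theta) * theta0 + theta * theta1.
Let asharp t := c0 t `^ (1 - theta) * c1 t `^ theta * a (rho t).
Let X0 := interpL A0 A1 theta0 r0 b0 q0 a0.
Let X1 := interpR A0 A1 theta1 r1 b1 q1 a1.

Let A0_ge0 : nonneg_norm A0. Proof. by case: qA0. Qed.
Let A1_ge0 : nonneg_norm A1. Proof. by case: qA1. Qed.

Let X0_ge0 : nonneg_norm X0.
Proof. exact: (limspace_nonneg (sg := true)). Qed.
Let X1_ge0 : nonneg_norm X1.
Proof. exact: (limspace_nonneg (sg := false)). Qed.

Let rv_c0 : rv 0 c0.
Proof. exact: (@limspace_weight_rv _ true r0 b0 a0). Qed.
Let rv_c1 : rv 0 c1.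
Proof. exact: (@limspace_weight_rv _ false r1 b1 a1). Qed.

Let c0_gt0 t : 0 < t -> 0 < c0 t. Proof. exact: rv_c0.1. Qed.
Let c1_gt0 t : 0 < t -> 0 < c1 t. Proof. exact: rv_c1.1. Qed.

Let kap1_gt0 : 0 < theta1 - theta0. Proof. by rewrite subr_gt0. Qed.

Let rv_rho : rv (theta1 - theta0) rho.
Proof.
by have := rv_mul (rv_pow (theta1 - theta0)) (rv_div rv_c0 rv_c1); rewrite subr0 addr0.
Qed.

Let rho_gt0 t : 0 < t -> 0 < rho t. Proof. exact: rv_rho.1. Qed.

Let rv_asharp : rv 0 asharp.
Proof.
have := rv_mul (rv_mul (rv_powR (1 - theta) rv_c0) (rv_powR theta rv_c1)) (rv0_comp ha rv_rho).
by rewrite !mul0r !addr0.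
Qed.

(* [rho ^ (- theta) a(rho)]: the weight of the outer functor pulled back by rho *)
Let w t := a (rho t) * rho t `^ (- theta).

Let asharpE t : 0 < t -> asharp t * t `^ (- eta) = w t * (c0 t * t `^ (- theta0)).
Proof.
move=> t0; have h0 := c0_gt0 t0; have h1 := c1_gt0 t0.
have E : c0 t `^ (1 - theta) * c1 t `^ theta * t `^ (- eta) =
    rho t `^ (- theta) * (c0 t * t `^ (- theta0)).
  (* In logarithms the identity is linear in ln t, ln c0(t) and ln c1(t). *)
  rewrite !powR_exp// ?rho_gt0// -[X in _ = _ * (X * _)](@lnK _ (c0 t)) ?posrE//.
  rewrite -!expRD; congr expR.
  rewrite /rho lnM ?posrE ?powR_gt0 ?divr_gt0// ln_powR ln_div ?posrE// /eta; ring.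
by rewrite /asharp /w -[RHS]mulrA -E; ring.
Qed.

Let w_gt0 t : 0 < t -> 0 < w t.
Proof. by move=> t0; rewrite mulr_gt0 ?powR_gt0 ?rho_gt0// ha.1// rho_gt0. Qed.

(** The reason for the form of [rho]: at the parameter rho(t) the two limiting norms of a piece
    living near [t] balance in the K-functional of the limiting couple. *)
Let rhoE t : 0 < t -> rho t * (c1 t * t `^ (- theta1)) = c0 t * t `^ (- theta0).
Proof.
move=> t0; have h1 := c1_gt0 t0; rewrite /rho.
have -> : t `^ (- theta0) = t `^ (theta1 - theta0) * t `^ (- theta1).
  by rewrite -powRD ?(gt_eqF t0) ?implybT//; congr powR; ring.
by field; rewrite gt_eqF.
Qed.

Let sum_sub f : sum_space X0 X1 f -> sum_space A0 A1 f.
Proof. by move=> [f0 [h0 _] [f1 [h1 _] <-]]; exact: sum_space_add. Qed.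

(** The lower bounds apply to the two pieces of an almost optimal decomposition in the limiting
    couple; quasi-additivity of the base K-functional recombines them, and [rhoE] supplies the
    factor of the second piece. *)
Lemma kfun_base_le : exists2 C, 0 < C & forall f t, 0 < t -> sum_space X0 X1 f ->
  c0 t * (t `^ (- theta0) * kfun A0 A1 t f) <= C * kfun X0 X1 (rho t) f.
Proof.
have [Cq Cq1 hCq] := kfun_quasi_add sA0 sA1 qA0 qA1.
have [C C_gt0 hC] := @limspace_lower _ _ _ _ A0_ge0 A1_ge0 true theta0 r0 q0 b0 a0
  hr0 hq0 hb0 ha0 hfin0.
have [D D_gt0 hD] := @limspace_lower _ _ _ _ A0_ge0 A1_ge0 false theta1 r1 q1 b1 a1
  hr1 hq1 hb1 ha1 hfin1.
have Cq0 : 0 < Cq by exact: lt_le_trans Cq1.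
have CD0 : 0 < C + D by rewrite addr_gt0.
exists (Cq * (C + D)) => [|f t t0 hf]; first exact: mulr_gt0.
rewrite leNgt -ltr_pdivlMl ?mulr_gt0//; apply/negP => h.
have [f0 [f1 [h0 h1 fE lf]]] := kfun_lt X0_ge0 X1_ge0 (rho_gt0 t0) hf h.
move: lf; rewrite ltr_pdivlMl ?mulr_gt0//; apply/negP; rewrite -leNgt.
have hk := hCq t f0 f1 t0 h0.1 h1.1; rewrite -fE in hk.
have z0 : 0 <= c0 t * t `^ (- theta0) by rewrite mulr_ge0 ?powR_ge0// ltW ?c0_gt0.
rewrite mulrA; apply: le_trans (ler_wpM2l z0 hk) _.
have k0 := hC f0 t t0 h0; have k1 := hD f1 t t0 h1.
rewrite -/(c0 t) in k0; rewrite -/(c1 t) in k1.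
have n0 := X0_ge0 h0; have n1 := X1_ge0 h1.
have e0 : c0 t * t `^ (- theta0) * kfun A0 A1 t f0 <= (C + D) * qnorm X0 f0.
  by rewrite -mulrA; apply: le_trans k0 _; rewrite ler_wpM2r// lerDl ltW.
have e1 : c0 t * t `^ (- theta0) * kfun A0 A1 t f1 <= (C + D) * (rho t * qnorm X1 f1).
  rewrite -rhoE// -mulrA [leRHS]mulrCA ler_wpM2l ?(ltW (rho_gt0 t0))// -mulrA.
  by apply: le_trans k1 _; rewrite ler_wpM2r// lerDr ltW.
have := ler_wpM2l (ltW Cq0) (lerD e0 e1); lra.
Qed.

(** A mere choice of approximate preimages. The only control on [tau] comes from [rv_proper]: it
    moves by a bounded log distance when its argument does. *)
Let rho_inverse : exists2 C, 0 < C & exists2 tau : R -> R,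
  forall u, 0 < u -> 0 < tau u & forall u, 0 < u -> dl (rho (tau u)) u <= C.
Proof.
have [C C_gt0 hC] := rv_quasi_inverse kap1_gt0 rv_rho.
pose P u t := 0 < u -> 0 < t /\ dl (rho t) u <= C.
have H u : exists t, P u t.
  (* For [u <= 0] the requirement is vacuous and 0 is a dummy value. *)
  have [u0|u0] := ltP 0 u; last by exists 0 => /lt_le_trans-/(_ _ u0); rewrite ltxx.
  by have [t t0 h] := hC u u0; exists t.
have [tau htau] := choice H.
by exists C => //; exists tau => u u0; case: (htau u u0).
Qed.

Lemma base_le_reiterated : exists2 C, 0 < C & forall f, sum_space X0 X1 f ->
  (haarLq r posR (fun t => (asharp t * (t `^ (- eta) * kfun A0 A1 t f))%:E) <=
   C%:E * haarLq r posR (fun u => (a u * (u `^ (- theta) * kfun X0 X1 u f))%:E))%E.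
Proof.
have [C1 C10 [tau tau0 htau]] := rho_inverse.
have [C2 C20 hC2] := kfun_base_le.
have [C3 C30 hC3] := rv_proper kap1_gt0 rv_rho.
have [D [P [D0 P0 hD]]] := weighted_kfun_temperate (V := V) theta ha.
(* Properness of [rho] turns the distance C1 + 1 + C1 between images into this bound for
   neighbouring values of [tau]; it also bounds the distance from [t] to [tau (rho t)]. *)
have [C4 C4E] : exists C4, C4 = C3 + 2 / (theta1 - theta0) * (C1 + 1 + C1) by eexists.
have k0 : 0 <= 2 / (theta1 - theta0) by rewrite divr_ge0// ltW.
have C40 : 0 < C4 by rewrite C4E ltr_wpDr// mulr_ge0// !addr_ge0// ltW.
have [D' D'E] : exists D', D' = D * expR P + C4 by eexists.
have D'0 : 0 < D' by rewrite D'E addr_gt0 ?mulr_gt0 ?expR_gt0.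
have C'0 : 0 < C2 * expR C4 by rewrite mulr_gt0 ?expR_gt0.
(* Any decay rate would serve: the hypothesis is used only at [s = rho t], where the kernel is
   bounded below. *)
have [C C_gt0 hC] := haarLq_transfer hr ltr01 D'0 C'0.
exists C => // f hf; have hf' := sum_sub hf.
apply: (hC _ _ tau) => // [s s0|t t0|s t s0 t0 st|s t s0 t0 st|t M t0 M0 H].
- by rewrite lee_fin !mulr_ge0 ?powR_ge0 ?kfun_ge0// ltW ?ha.1.
- rewrite lee_fin; apply: mulr_ge0; first exact/ltW/rv_asharp.1.
  by rewrite mulr_ge0 ?powR_ge0 ?kfun_ge0.
- rewrite -EFinM lee_fin; apply: le_trans (hD _ _ X0_ge0 X1_ge0 f s t hf s0 t0) _.
  rewrite ler_wpM2r ?mulr_ge0 ?powR_ge0 ?kfun_ge0 ?(ltW (ha.1 _ t0))//.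
  apply: (@le_trans _ _ (D * expR P)); last by rewrite D'E lerDl ltW.
  by rewrite ler_wpM2l ?(ltW D0)// ler_expR ler_piMr.
- have ts := tau0 s s0; have tt := tau0 t t0.
  apply: (@le_trans _ _ C4); last by rewrite D'E lerDr mulr_ge0 ?expR_ge0// ltW.
  apply: le_trans (hC3 _ _ ts tt) _; rewrite C4E lerD2l ler_wpM2l//.
  apply: le_trans (dl_triangle s _ _) _; rewrite -addrA; apply: lerD; first exact: htau.
  apply: le_trans (dl_triangle t _ _) _; apply: lerD => //.
  by rewrite dlC htau.
- have r0t := rho_gt0 t0; have := H (rho t) r0t; rewrite -EFinM !lee_fin => {}H.
  have dt : dl t (tau (rho t)) <= C4.
    apply: le_trans (hC3 _ _ t0 (tau0 _ r0t)) _; rewrite C4E lerD2l ler_wpM2l//.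
    by rewrite dlC; apply: le_trans (htau _ r0t) _; rewrite lerDr addr_ge0// ltW.
  have -> : asharp t * (t `^ (- eta) * kfun A0 A1 t f) =
      w t * (c0 t * (t `^ (- theta0) * kfun A0 A1 t f)).
    by rewrite mulrA asharpE//; ring.
  apply: le_trans (ler_wpM2l (ltW (w_gt0 t0)) (hC2 f t t0 hf)) _.
  have -> : w t * (C2 * kfun X0 X1 (rho t) f) =
     C2 * (a (rho t) * (rho t `^ (- theta) * kfun X0 X1 (rho t) f)).
    by rewrite /w; ring.
  rewrite -mulrA ler_wpM2l ?(ltW C20)//.
  set Z := a (rho t) * _ in H *; have Z0 : 0 <= Z.
    by rewrite /Z !mulr_ge0 ?powR_ge0 ?kfun_ge0// ltW ?ha.1.
  apply: le_trans (ler_wpM2l (expR_ge0 _) H); rewrite mulrA -expRD.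
  by rewrite ler_peMl// -[leLHS]expR0 ler_expR; lra.
Qed.

(** The first two gaps give decay where a piece is controlled through [f], the last two where it is
    controlled by its own norm in [A0] or [A1]. With a quarter of each, growth at rate 2 delta still
    leaves decay at rate delta. *)
Let delta := Num.min (Num.min (eta - theta0) (theta1 - eta)) (Num.min theta0 (1 - theta1)) / 4.

Let eta_bounds : [/\ 0 < delta, 4 * delta <= eta - theta0, 4 * delta <= theta1 - eta,
  4 * delta <= theta0 & 4 * delta <= 1 - theta1].
Proof.
have e1 : 0 < eta - theta0.
  by rewrite (_ : _ - _ = theta * (theta1 - theta0)) ?mulr_gt0// /eta; ring.
have e2 : 0 < theta1 - eta.
  rewrite (_ : _ - _ = (1 - theta) * (theta1 - theta0)); last by rewrite /eta; ring.
  by rewrite mulr_gt0// subr_gt0.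
have -> : 4 * delta = Num.min (Num.min (eta - theta0) (theta1 - eta)) (Num.min theta0 (1 - theta1)).
  by rewrite /delta; field.
split.
- by rewrite divr_gt0// !lt_min e1 e2 htheta0 subr_gt0 htheta1.
- by rewrite !ge_min lexx.
- by rewrite !ge_min lexx orbT.
- by rewrite !ge_min lexx !orbT.
- by rewrite !ge_min lexx !orbT.
Qed.

(** Each piece has two bounds. Its own norm controls [f0] for u > t and [f1] for u <= t; on the
    opposite range, [f0 = f - f1] and [f1 = f - f0] are controlled by K(u, f) and the norm of the
    other piece. *)
Lemma kfun_split Cq : 1 <= Cq ->
  (forall t f g, 0 < t -> sum_space A0 A1 f -> sum_space A0 A1 g ->
     kfun A0 A1 t (f + g) <= Cq * (kfun A0 A1 t f + kfun A0 A1 t g)) ->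
  forall f t B, 0 < t -> 0 < B -> sum_space A0 A1 f ->
  (forall u, 0 < u -> kfun A0 A1 u f <=
     B * expR (2 * delta * dl u t + eta * (ln u - ln t))) ->
  exists f0 f1, [/\ f = f0 + f1, sum_space A0 A1 f0, sum_space A0 A1 f1,
    forall u, 0 < u -> u `^ (- theta0) * kfun A0 A1 u f0 <=
      3 * Cq * B * t `^ (- theta0) * expR (- delta * dl u t) &
    forall u, 0 < u -> u `^ (- theta1) * kfun A0 A1 u f1 <=
      3 * Cq * B * t `^ (- theta1) * expR (- delta * dl u t)].
Proof.
move=> Cq1 hCq f t B t0 B0 hf hk.
have [de0 d1 d2 d3 d4] := eta_bounds.
have Cq0 : 0 < Cq by exact: lt_le_trans Cq1.
(* The factor 2 creates the strict inequality that yields an actual decomposition. *)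
have ktB : kfun A0 A1 t f < 2 * B.
  have := hk t t0; rewrite subrr mulr0 addr0 /dl subrr normr0 mulr0 expR0 mulr1; lra.
have [f0 [f1 [h0 h1 fE lf]]] := kfun_lt A0_ge0 A1_ge0 t0 hf ktB.
have [z0 _] := sA0; have [z1 _] := sA1.
have n00 : qnorm A0 0 = 0 by case: qA0 => _ H _ _; apply/H.
have n10 : qnorm A1 0 = 0 by case: qA1 => _ H _ _; apply/H.
have [h0N n0N] := quasi_norm_opp sA0 qA0 h0.
have [h1N n1N] := quasi_norm_opp sA1 qA1 h1.
have s0 : sum_space A0 A1 f0 by exists f0 => //; exists 0 => //; rewrite addr0.
have s1 : sum_space A0 A1 f1 by exists 0 => //; exists f1 => //; rewrite add0r.
have s0N : sum_space A0 A1 (- f0) by exists (- f0) => //; exists 0 => //; rewrite addr0.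
have s1N : sum_space A0 A1 (- f1) by exists 0 => //; exists (- f1) => //; rewrite add0r.
have p0 := A0_ge0 h0; have p1 := mulr_ge0 (ltW t0) (A1_ge0 h1).
have nb0 : qnorm A0 f0 <= 2 * B by lra.
have nb1 u : 0 < u -> u * qnorm A1 f1 <= 2 * B * expR (ln u - ln t).
  move=> u0; have -> : u * qnorm A1 f1 = t * qnorm A1 f1 * expR (ln u - ln t).
    by rewrite expRB !lnK ?posrE//; field; rewrite gt_eqF.
  by rewrite ler_wpM2r ?expR_ge0//; lra.
have k00 u : 0 < u -> kfun A0 A1 u f0 <= 2 * B.
  move=> u0; have := kfun_le A0_ge0 A1_ge0 u0 h0 z1.
  by rewrite n10 mulr0 !addr0 => /le_trans; apply.
have k01 u : 0 < u -> kfun A0 A1 u f0 <=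
    Cq * (B * expR (2 * delta * dl u t + eta * (ln u - ln t)) + 2 * B * expR (ln u - ln t)).
  move=> u0; have -> : f0 = f + - f1 by rewrite fE addrK.
  apply: le_trans (hCq u _ _ u0 hf s1N) _; rewrite ler_wpM2l ?(ltW Cq0)//.
  apply: lerD; first exact: hk.
  have := kfun_le A0_ge0 A1_ge0 u0 z0 h1N; rewrite n00 n1N !add0r => /le_trans; apply.
  exact: nb1.
have k10 u : 0 < u -> kfun A0 A1 u f1 <= 2 * B * expR (ln u - ln t).
  move=> u0; have := kfun_le A0_ge0 A1_ge0 u0 z0 h1; rewrite n00 !add0r => /le_trans.
  by apply; exact: nb1.
have k11 u : 0 < u -> kfun A0 A1 u f1 <=
    Cq * (B * expR (2 * delta * dl u t + eta * (ln u - ln t)) + 2 * B).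
  move=> u0; have -> : f1 = f + - f0 by rewrite fE addrC addKr.
  apply: le_trans (hCq u _ _ u0 hf s0N) _; rewrite ler_wpM2l ?(ltW Cq0)//.
  apply: lerD; first exact: hk.
  have := kfun_le A0_ge0 A1_ge0 u0 h0N z1; rewrite n10 n0N mulr0 !addr0 => /le_trans.
  by apply.
have BC : 2 * B <= 3 * Cq * B.
  by rewrite ler_wpM2r ?(ltW B0)//; lra.
have powu al u : 0 < u -> u `^ (- al) = t `^ (- al) * expR (- al * (ln u - ln t)).
  by move=> u0; rewrite !powR_exp// -expRD; congr expR; ring.
(* [fin1] serves the bounds by the piece's own norm, [fin2] those passing through [f]; the constant
   3 is 1 + 2, from K(u, f) and the other piece. *)
have fin1 al x u y : 0 < u -> y - al * (ln u - ln t) <= - delta * dl u t ->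
    x <= 2 * B * expR y ->
    u `^ (- al) * x <= 3 * Cq * B * t `^ (- al) * expR (- delta * dl u t).
  move=> u0 hy hx; apply: le_trans (ler_wpM2l (powR_ge0 _ _) hx) _; rewrite powu//.
  rewrite [leLHS](_ : _ = t `^ (- al) * (2 * B * expR (y - al * (ln u - ln t)))); last first.
    by rewrite expRD mulNr; ring.
  rewrite [leRHS](_ : _ = t `^ (- al) * (3 * Cq * B * expR (- delta * dl u t))); last by ring.
  rewrite ler_wpM2l ?powR_ge0//; apply: ler_pM; rewrite ?expR_ge0 ?ler_expR//.
  by rewrite mulr_ge0// ltW.
have fin2 al x u y z : 0 < u -> y - al * (ln u - ln t) <= - delta * dl u t ->
    z - al * (ln u - ln t) <= - delta * dl u t ->
    x <= Cq * (B * expR y + 2 * B * expR z) ->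
    u `^ (- al) * x <= 3 * Cq * B * t `^ (- al) * expR (- delta * dl u t).
  move=> u0 hy hz hx; apply: le_trans (ler_wpM2l (powR_ge0 _ _) hx) _; rewrite powu//.
  rewrite [leLHS](_ : _ = t `^ (- al) * (Cq * B * expR (y - al * (ln u - ln t)) +
      Cq * B * 2 * expR (z - al * (ln u - ln t)))); last first.
    by rewrite !expRD mulNr; ring.
  rewrite [leRHS](_ : _ = t `^ (- al) * (Cq * B * expR (- delta * dl u t) +
      Cq * B * 2 * expR (- delta * dl u t))); last by ring.
  have CB0 : 0 <= Cq * B by rewrite mulr_ge0// ltW.
  rewrite ler_wpM2l ?powR_ge0//; apply: lerD; rewrite ler_wpM2l ?ler_expR//.
  by rewrite mulr_ge0.
have mono (x y z : R) : 0 <= z -> x <= y -> x * z <= y * z by move=> *; exact: ler_wpM2r.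
exists f0, f1; split=> // u u0.
  have [ut|ut] := lerP u t.
    have d : dl u t = - (ln u - ln t) by rewrite /dl ler0_norm// subr_le0 ler_ln.
    have x0 := dl_ge0 u t.
    apply: fin2 (k01 u u0) => //.
      have := mono _ _ _ x0 d1; have := mono _ _ _ x0 (ltW de0); rewrite d; lra.
    have h : 4 * delta <= 1 - theta0 by lra.
    have := mono _ _ _ x0 h; have := mono _ _ _ x0 (ltW de0); rewrite d; lra.
  have d : dl u t = ln u - ln t by rewrite /dl ger0_norm// subr_ge0 ler_ln ?ltW.
  have x0 := dl_ge0 u t.
  apply: (fin1 _ _ _ 0) => //; last by rewrite expR0 mulr1 k00.
  have := mono _ _ _ x0 d3; have := mono _ _ _ x0 (ltW de0); rewrite d; lra.
have [ut|ut] := lerP u t.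
  have d : dl u t = - (ln u - ln t) by rewrite /dl ler0_norm// subr_le0 ler_ln.
  have x0 := dl_ge0 u t.
  apply: fin1 (k10 u u0) => //.
  have := mono _ _ _ x0 d4; have := mono _ _ _ x0 (ltW de0); rewrite d; lra.
have d : dl u t = ln u - ln t by rewrite /dl ger0_norm// subr_ge0 ler_ln ?ltW.
have x0 := dl_ge0 u t.
apply: (fin2 _ _ _ (2 * delta * dl u t + eta * (ln u - ln t)) 0) => //; last first.
- by rewrite expR0 mulr1 k11.
- have h : 4 * delta <= theta1 by lra.
  have := mono _ _ _ x0 h; have := mono _ _ _ x0 (ltW de0); rewrite d; lra.
- have := mono _ _ _ x0 d2; have := mono _ _ _ x0 (ltW de0); rewrite d; lra.
Qed.

Lemma kfun_reiterated_le : exists2 C, 0 < C & forall f t M, 0 < t -> 0 < M ->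
  sum_space A0 A1 f ->
  (forall s, 0 < s -> asharp s * (s `^ (- eta) * kfun A0 A1 s f) <= M * expR (delta * dl s t)) ->
  sum_space X0 X1 f /\ w t * kfun X0 X1 (rho t) f <= C * M.
Proof.
have [de0 _ _ _ _] := eta_bounds.
have [Cq Cq1 hCq] := kfun_quasi_add sA0 sA1 qA0 qA1.
have Cq0 : 0 < Cq by exact: lt_le_trans Cq1.
have [Cs Cs0 hCs] := rv0_small rv_asharp de0.
have [U0 U00 hU0] := @limspace_upper _ _ _ _ A0_ge0 A1_ge0 true theta0 r0 q0 b0 a0
  hr0 hq0 hb0 ha0 hfin0 _ de0.
have [U1 U10 hU1] := @limspace_upper _ _ _ _ A0_ge0 A1_ge0 false theta1 r1 q1 b1 a1
  hr1 hq1 hb1 ha1 hfin1 _ de0.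
exists (3 * Cq * (U0 + U1) * Cs) => [|f t M t0 M0 hf hM].
  by rewrite !mulr_gt0 ?addr_gt0.
have as0 := rv_asharp.1 t t0.
(* The bound for K(t, f) read off from the hypothesis at [t], up to [Cs]. Moving [asharp] from [u]
   to [t] costs another rate delta, whence the 2 delta in [hk]. *)
have [B BE] : exists B, B = Cs * M * t `^ eta / asharp t by eexists.
have B0 : 0 < B.
  by rewrite BE; apply: divr_gt0 => //; apply: mulr_gt0; [exact: mulr_gt0|exact: powR_gt0].
have hk u : 0 < u -> kfun A0 A1 u f <= B * expR (2 * delta * dl u t + eta * (ln u - ln t)).
  move=> u0; have ue : u `^ eta * u `^ (- eta) = 1.
    by rewrite powRN mulfV// gt_eqF// powR_gt0.
  have z0 : 0 <= u `^ (- eta) * kfun A0 A1 u f by rewrite mulr_ge0 ?powR_ge0 ?kfun_ge0.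
  have h1 : asharp t * (u `^ (- eta) * kfun A0 A1 u f) <=
      Cs * expR (delta * dl u t) * (M * expR (delta * dl u t)).
    apply: le_trans (ler_wpM2r z0 (hCs t u t0 u0)) _.
    rewrite [leLHS](_ : _ = Cs * expR (delta * dl u t) *
      (asharp u * (u `^ (- eta) * kfun A0 A1 u f))); last by rewrite (dlC t u) !mulrA.
    by rewrite ler_wpM2l ?hM// mulr_ge0 ?expR_ge0// ltW.
  have -> : kfun A0 A1 u f = u `^ eta / asharp t * (asharp t * (u `^ (- eta) * kfun A0 A1 u f)).
    rewrite -[LHS]mul1r -{1}ue; field; by rewrite gt_eqF.
  apply: le_trans (ler_wpM2l _ h1) _.
    by apply: divr_ge0; [exact: powR_ge0|exact: ltW].
  have -> : u `^ eta = t `^ eta * expR (eta * (ln u - ln t)).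
    by rewrite !powR_exp// -expRD; congr expR; ring.
  have -> : 2 * delta * dl u t + eta * (ln u - ln t) =
      delta * dl u t + delta * dl u t + eta * (ln u - ln t) by ring.
  rewrite BE !expRD le_eqVlt; apply/orP; left; apply/eqP; ring.
have [f0 [f1 [fE s0 s1 hf0 hf1]]] := kfun_split Cq1 hCq t0 B0 hf hk.
have B00 : 0 < 3 * Cq * B * t `^ (- theta0) by rewrite !mulr_gt0 ?powR_gt0.
have B10 : 0 < 3 * Cq * B * t `^ (- theta1) by rewrite !mulr_gt0 ?powR_gt0.
have [h0 n0] := hU0 f0 t _ t0 B00 s0 hf0.
have [h1 n1] := hU1 f1 t _ t0 B10 s1 hf1.
rewrite -/(c0 t) in n0; rewrite -/(c1 t) in n1.
split; first by exists f0 => //; exists f1.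
have wt := w_gt0 t0; have rt := rho_gt0 t0.
apply: (@le_trans _ _ (w t * (U0 * (3 * Cq * B * t `^ (- theta0) * c0 t) +
    rho t * (U1 * (3 * Cq * B * t `^ (- theta1) * c1 t))))).
  rewrite ler_wpM2l ?(ltW wt)// fE.
  apply: le_trans (kfun_le X0_ge0 X1_ge0 rt h0 h1) _; apply: lerD; first exact: n0.
  by rewrite ler_wpM2l ?(ltW rt).
rewrite (_ : w t * _ = 3 * Cq * B * (U0 * (w t * (c0 t * t `^ (- theta0))) +
   U1 * (w t * (rho t * (c1 t * t `^ (- theta1)))))); last by ring.
(* Both summands now carry the same factor asharp(t) t^(-eta), which cancels [B] up to [Cs * M]. *)
rewrite rhoE// -asharpE// BE.
have te : t `^ eta * t `^ (- eta) = 1 by rewrite powRN mulfV// gt_eqF// powR_gt0.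
rewrite (_ : _ * _ = 3 * Cq * (U0 + U1) * Cs * M * (t `^ eta * t `^ (- eta))).
  by rewrite te mulr1.
by field; rewrite gt_eqF.
Qed.

(** Bridges the gap between the transfer, which allows M = 0, and [kfun_reiterated_le], which takes
    M > 0. *)
Lemma le_of_gt (x C M : R) : 0 < C -> (forall M', M < M' -> x <= C * M') -> x <= C * M.
Proof.
move=> C_gt0 H; rewrite -ler_pdivrMl//; apply/ler_addgt0Pr => e e0.
by rewrite ler_pdivrMl// H// ltrDl.
Qed.

Lemma reiterated_le_base : exists2 C, 0 < C & forall f, sum_space A0 A1 f ->
  (haarLq r posR (fun t => (asharp t * (t `^ (- eta) * kfun A0 A1 t f))%:E) < +oo)%E ->
  sum_space X0 X1 f /\
  (haarLq r posR (fun u => (a u * (u `^ (- theta) * kfun X0 X1 u f))%:E) <=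
   C%:E * haarLq r posR (fun t => (asharp t * (t `^ (- eta) * kfun A0 A1 t f))%:E))%E.
Proof.
have [de0 _ _ _ _] := eta_bounds.
have [C1 C10 [tau tau0 htau]] := rho_inverse.
have [C2 C20 hC2] := kfun_reiterated_le.
have [C3 C30 hC3] := rv_dl rv_rho.
have [C4 C40 hC4] := haarLq_sup hr.
have [D [P [D0 P0 hD]]] := weighted_kfun_temperate (V := V) eta rv_asharp.
have [D' [P' [D'0 P'0 hD']]] := weighted_kfun_temperate (V := V) theta ha.
have [n nE] : exists n, n = `|theta1 - theta0| + 1 by eexists.
rewrite -nE in hC3; have n0 : 0 < n by rewrite nE ltr_wpDl.
(* [rho] stretches log distances by at most [n], up to a constant, so the rate delta/n in the
   variable u = rho(t) becomes the rate delta in [t]. *)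
have e0 : 0 < delta / n by exact: divr_gt0.
have [Q QE] : exists Q, Q = D * expR P + (C3 + n) by eexists.
have Q0 : 0 < Q.
  by rewrite QE; apply: addr_gt0; [rewrite mulr_gt0 ?expR_gt0|exact: addr_gt0].
have [K KE] : exists K, K = D' * expR (P' * C1) * C2 * expR (delta / n * (C1 + C3)) by eexists.
have K0 : 0 < K by rewrite KE !mulr_gt0 ?expR_gt0.
have [C C_gt0 hC] := haarLq_transfer hr e0 Q0 K0.
exists C => // f hf Gfin.
pose G s := asharp s * (s `^ (- eta) * kfun A0 A1 s f).
have G0 s : 0 < s -> 0 <= G s.
  move=> s0; apply: mulr_ge0; first exact/ltW/rv_asharp.1.
  by rewrite mulr_ge0 ?powR_ge0 ?kfun_ge0.
have GQ s t : 0 < s -> 0 < t -> dl s t <= 1 -> G s <= Q * G t.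
  move=> s0 t0 st; apply: le_trans (hD _ _ A0_ge0 A1_ge0 f s t hf s0 t0) _.
  rewrite ler_wpM2r ?G0//; apply: (@le_trans _ _ (D * expR P)).
    by rewrite ler_wpM2l ?(ltW D0)// ler_expR ler_piMr.
  by rewrite QE lerDl ltW// addr_gt0.
(* A finite norm bounds [G] pointwise, which already gives a decomposition at the single point t =
   1; the added 1 makes the bound positive. *)
have fX : sum_space X0 X1 f.
  pose L := fine (haarLq r posR (fun s => (G s)%:E)).
  have LE : (haarLq r posR (fun s => (G s)%:E) = L%:E)%E.
    by rewrite fineK// ge0_fin_numE// haarLq_ge0.
  have L0 : 0 <= L by rewrite fine_ge0 ?haarLq_ge0.
  have M0 : 0 < C4 * Q * L + 1 by rewrite ltr_wpDl// !mulr_ge0// ltW.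
  have [] // := hC2 f 1 (C4 * Q * L + 1) ltr01 M0 hf.
  move=> s s0; have : ((G s)%:E <= (C4 * Q)%:E * haarLq r posR (fun s => (G s)%:E))%E.
    by apply: hC4.
  rewrite LE -EFinM lee_fin => h; apply: le_trans h _.
  apply: (@le_trans _ _ (C4 * Q * L + 1)); first by rewrite lerDl.
  by rewrite ler_peMr ?(ltW M0)// -expR0 ler_expR mulr_ge0 ?dl_ge0// ltW.
split=> //.
apply: (hC _ _ rho) => // [u u0|s t s0 t0 st|u M u0 M0 H].
- by rewrite lee_fin !mulr_ge0 ?powR_ge0 ?kfun_ge0// ltW ?ha.1.
- apply: le_trans (hC3 s t s0 t0) _; rewrite QE -[leLHS]add0r; apply: lerD.
    by rewrite mulr_ge0 ?expR_ge0// ltW.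
  by rewrite lerD2l ler_piMr// ltW.
(* The estimate is known only at points rho(t); passing from [u] to [rho (tau u)] costs the constant
   factor [D' * expR (P' * C1)]. *)
have t0 := tau0 u u0; have tu := htau u u0; set t := tau u in t0 tu.
rewrite lee_fin; apply: le_trans (hD' _ _ X0_ge0 X1_ge0 f u (rho t) fX u0 (rho_gt0 t0)) _.
have hw : w t * kfun X0 X1 (rho t) f <= C2 * (M * expR (delta / n * (C1 + C3))).
  apply: le_of_gt => // M' MM'.
  have M'0 : 0 < M' by apply: le_lt_trans MM'; rewrite mulr_ge0 ?expR_ge0.
  apply: (hC2 f t M' t0 M'0 hf _).2 => s s0.
  have := H s s0; rewrite -EFinM lee_fin -/(G s) mulrC mulNr expRN ler_pdivrMr ?expR_gt0// => h.
  apply: le_trans h _; apply: (@le_trans _ _ (M * expR (delta / n * (C1 + C3)) * expR (delta * dl s t))).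
    rewrite -mulrA -expRD ler_wpM2l// ler_expR.
    have d1 : dl u (rho s) <= C1 + C3 + n * dl s t.
      apply: le_trans (dl_triangle (rho t) _ _) _; rewrite dlC -addrA; apply: lerD => //.
      by rewrite dlC; exact: hC3.
    apply: le_trans (ler_wpM2l (ltW e0) d1) _; rewrite mulrDr lerD2l mulrA divfK//.
    by rewrite gt_eqF.
  by rewrite ler_wpM2r ?expR_ge0// ltW.
have -> : a (rho t) * (rho t `^ (- theta) * kfun X0 X1 (rho t) f) =
   w t * kfun X0 X1 (rho t) f by rewrite /w; ring.
apply: le_trans (ler_wpM2l _ hw) _; first by rewrite mulr_ge0 ?expR_ge0// ltW.
have -> : K * M = D' * expR (P' * C1) * (C2 * (M * expR (delta / n * (C1 + C3)))).
  by rewrite KE; ring.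
rewrite ler_wpM2r ?mulr_ge0 ?expR_ge0 ?(ltW C20)// ler_wpM2l ?(ltW D'0)// ler_expR.
by rewrite ler_wpM2l// dlC.
Qed.

Lemma reiteration : space_equiv (interp X0 X1 theta r a) (interp A0 A1 eta r asharp).
Proof.
have posS : (`]0, +oo[%classic : set R) `<=` posR by [].
split.
  have [C C_gt0 hC] := base_le_reiterated; exists C => // f [hf Nf].
  have hf' := sum_sub hf; have := hC f hf.
  rewrite /= !Knorm_haarLq// in Nf *; set L := haarLq _ _ _; set N := haarLq _ _ _ in Nf *.
  move=> h; have L0 : (0 <= L)%E by exact: haarLq_ge0.
  have N0 : (0 <= N)%E by exact: haarLq_ge0.
  have Nfin : N \is a fin_num by rewrite ge0_fin_numE.
  have Lfin : (L < +oo)%E by apply: le_lt_trans h _; rewrite -(fineK Nfin) -EFinM ltry.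
  by split=> //; rewrite -lee_fin EFinM !fineK// ge0_fin_numE.
have [C C_gt0 hC] := reiterated_le_base; exists C => // f [hf Nf].
rewrite /= Knorm_haarLq// in Nf.
have [hf' h] := hC f hf Nf.
rewrite /= !Knorm_haarLq//; set L := haarLq _ _ _ in h *; set N := haarLq _ _ _ in Nf h *.
have L0 : (0 <= L)%E by exact: haarLq_ge0.
have N0 : (0 <= N)%E by exact: haarLq_ge0.
have Nfin : N \is a fin_num by rewrite ge0_fin_numE.
have Lfin : (L < +oo)%E by apply: le_lt_trans h _; rewrite -(fineK Nfin) -EFinM ltry.
by split=> //; rewrite -lee_fin EFinM !fineK// ge0_fin_numE.
Qed.

End Reiteration.

Theorem theorem26 (R : realType) (E : topologicalLmodType R)
    (A0 A1 : qspace E) (hA : compatible_couple A0 A1)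
    (hA01 : carrier A0 `&` carrier A1 <> [set 0])
    (theta0 theta1 theta : R)
    (htheta0 : 0 < theta0) (htheta01 : theta0 < theta1) (htheta1 : theta1 < 1)
    (htheta : 0 < theta) (htheta' : theta < 1)
    (r r0 r1 q0 q1 : \bar R)
    (hr : (0 < r)%E) (hr0 : (0 < r0)%E) (hr1 : (0 < r1)%E)
    (hq0 : (0 < q0)%E) (hq1 : (0 < q1)%E)
    (a a0 a1 b0 b1 : R -> R)
    (ha : SV a) (ha0 : SV a0) (ha1 : SV a1) (hb0 : SV b0) (hb1 : SV b1)
    (hfin0 : (ratio_norm r0 b0 a0 `]1%R, +oo[ < +oo)%E)
    (hfin1 : (ratio_norm r1 b1 a1 `]0%R, 1%R[ < +oo)%E) :
  let c0 := fun t : R => a0 t * fine (ratio_norm r0 b0 a0 `]t, +oo[) in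
  let c1 := fun t : R => a1 t * fine (ratio_norm r1 b1 a1 `]0, t[) in
  let rho := fun t : R => t `^ (theta1 - theta0) * (c0 t / c1 t) in
  let eta := (1 - theta) * theta0 + theta * theta1 in
  let asharp := fun t : R => c0 t `^ (1 - theta) * c1 t `^ theta * a (rho t) in
  space_equiv
    (interp (interpL A0 A1 theta0 r0 b0 q0 a0)
            (interpR A0 A1 theta1 r1 b1 q1 a1) theta r a)
    (interp A0 A1 eta r asharp).
Proof.
case: hA => _ [sA0 qA0 _] [sA1 qA1 _] _ _.
by apply: reiteration => //; exact: SV_rv.
Qed.
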